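(* Let $D\ge 1$ and let $v\in\mathbb{T}^D$ be a totally irrational rotation vector which is Diophantine, i.e. there are constants $c>0$ and $d>1$ with $\operatorname{dist}(nv,0)\ge c\cdot n^{-d}$ for all integers $n\ge 1$. For $\kappa>0$ let $$F_\kappa:\mathbb{T}^D\times[0,1]\to\mathbb{T}^D\times[0,1],\qquad F_\kappa(\theta,x)=\bigl(\theta+v,\ \tanh(\kappa x)\cdot g(\theta)\bigr),\qquad g(\theta)=\frac1D\sum_{i=1}^D\sin(\pi\theta_i),$$ and let $\kappa_0=e^{-\int_{\mathbb{T}^D}\log g(\theta)\,d\theta}$. For $\kappa>\kappa_0$ denote by $\mathbb{P}_\kappa$ the unique physical measure of $F_\kappa$, and for $N\in\mathbb{N}$ let $$p_{\kappa,N}=\mathbb{P}_\kappa\bigl(\{(\theta,x)\in\mathbb{T}^D\times[0,1] : \lambda_N(\theta,x)>0\}\bigr),$$ where $\lambda_N$ is the time-$N$ Lyapunov exponent of $F_\kappa$. Then there exists $\kappa_1>\kappa_0$ such that for all $\kappa\ge\kappa_1$ there are constants $\gamma_+\ge\gamma_->0$ (depending on $\kappa$) such that $$\exp(-\gamma_+N)\le p_{\kappa,N}\le\exp(-\gamma_-N)$$ holds for all $N\in\mathbb{N}$.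
   Context: $\mathbb{T}^D=\mathbb{R}^D/\mathbb{Z}^D$, with coordinates $\theta_i\in[0,1)$, and $\operatorname{dist}$ is the metric on $\mathbb{T}^D$ induced by the Euclidean metric; $d\theta$ is Lebesgue (Haar) probability measure. $\mathbb{N}=\{1,2,\dots\}$. A vector $v\in\mathbb{T}^D$ is totally irrational if there is no non-zero $n\in\mathbb{Z}^D$ with $\langle v,n\rangle\in\mathbb{Z}$. For $N\in\mathbb{N}$, the time-$N$ Lyapunov exponent is $\lambda_N(\theta,x)=\frac1N\log\bigl(\partial_xF^N_{\kappa,\theta}(x)\bigr)$, where $F^N_{\kappa,\theta}(x)$ denotes the second coordinate of the $N$-th iterate $F_\kappa^N(\theta,x)$ (and $\log 0=-\infty$). A physical measure of $F_\kappa$ is an $F_\kappa$-invariant ergodic Borel probability measure $\mathbb{P}$ for which there is a set $V\subseteq\mathbb{T}^D\times[0,1]$ of positive Lebesgue measure such that for every continuous $f:\mathbb{T}^D\times[0,1]\to\mathbb{R}$ and all $(\theta,x)\in V$ one has $\lim_{n\to\infty}\frac1n\sum_{\ell=0}^{n-1}f(F_\kappa^\ell(\theta,x))=\int f\,d\mathbb{P}$. It is known (Keller) that for every $\kappa>\kappa_0$ there is a unique physical measure $\mathbb{P}_\kappa$, and that it is given by $\mathbb{P}_\kappa(A)=\operatorname{Leb}_{\mathbb{T}^D}(\{\theta:(\theta,\phi^+(\theta))\in A\})$, where $\phi^+(\theta)=\sup\{x\in[0,1]:(\theta,x)\in\bigcap_{n\in\mathbb{N}}F_\kappa^n(\mathbb{T}^D\times[0,1])\}$.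 *)

(* Defs.v *)
From HB Require Import structures.
From mathcomp Require Import all_boot all_order all_algebra.
From mathcomp Require Import all_classical all_reals all_analysis.

Set Implicit Arguments.
Unset Strict Implicit.
Unset Printing Implicit Defensive.

Import Order.TTheory GRing.Theory Num.Theory.
Import numFieldNormedType.Exports.

Local Open Scope classical_set_scope.
Local Open Scope ring_scope.
Local Open Scope quotient_scope.

Section Torus.
Variables (R : realType) (D : nat).

Definition lattice : {pred 'rV[R]_D} := fun a => a \is a mxOver Num.int.

Lemma lattice_zmod_closed : zmod_closed lattice.
Proof.
split=> [|a b]; rewrite /lattice !unfold_in.
  by apply/forallP => i; apply/forallP => j; rewrite mxE rpred0.
move=> /mxOverP ha /mxOverP hb; apply/mxOverP => i j.
by rewrite !mxE rpredB.
Qed.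

HB.instance Definition _ :=
  GRing.isZmodClosed.Build _ lattice lattice_zmod_closed.

Definition torus : Type :=
  @Quotient.quot 'rV[R]_D (GRing.ZmodClosed.clone _ lattice _).

HB.instance Definition _ := ZmodQuotient.on torus.
HB.instance Definition _ := GRing.Zmodule.on torus.
HB.instance Definition _ := isPointed.Build torus 0.

Definition torus_proj (a : 'rV[R]_D) : torus := \pi_torus a.

Definition torus_open (U : set torus) : Prop := open (torus_proj @^-1` U).

Lemma torus_openT : torus_open setT.
Proof. by rewrite /torus_open preimage_setT; exact: openT. Qed.

Lemma torus_openI : setI_closed torus_open.
Proof. by move=> U V; exact: openI. Qed.

Lemma torus_open_bigU (I : Type) (f : I -> set torus) :
  (forall i, torus_open (f i)) -> torus_open (\bigcup_i f i).
Proof. by move=> of_; apply: bigcup_open => i _; exact: of_. Qed.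

HB.instance Definition _ :=
  @isOpenTopological.Build torus torus_open
    torus_openT torus_openI torus_open_bigU.

HB.instance Definition _ :=
  @isMeasurable.Build (sigma_display (@open torus)) torus <<s (@open torus) >>
    (@sigma_algebra0 _ setT (@open torus)) (@sigma_algebraC _ (@open torus))
    (@sigma_algebra_bigcup _ setT (@open torus)).

End Torus.
Section TorusLebesgue.
Variable R : realType.

Definition tuple_cons n (p : measurableTypeR R * n.-tuple R) : n.+1.-tuple R :=
  [the n.+1.-tuple R of p.1 :: p.2].

Lemma measurable_tuple_cons n :
  measurable_fun [set: _] (@tuple_cons n).
Proof. exact: (@measurable_cons _ _ _ R fst). Qed.

HB.instance Definition _ n :=
  isMeasurableFun.Build _ _ _ _ (@tuple_cons n) (@measurable_tuple_cons n).

Fixpoint cube_prob (n : nat) : probability (n.-tuple R) R :=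
  match n with
  | 0 => \d_([tuple] : 0.-tuple R)
  | m.+1 => distribution (uniform_prob (@ltr01 R) \x cube_prob m)%E (@tuple_cons m)
  end.

Variable D : nat.

Definition torus_of_tuple (t : D.-tuple R) : torus R D :=
  torus_proj (\row_i tnth t i).

Lemma measurable_box (a : 'I_D -> R) (e : R) :
  measurable [set t : D.-tuple R | forall i, ball (a i) e (tnth t i)].
Proof.
rewrite (_ : [set _ | _] =
    \bigcap_(i in [set: 'I_D]) ((fun t => tnth t i) @^-1` ball (a i) e)).
  apply: fin_bigcap_measurable => // i _; rewrite -[X in measurable X]setTI.
  by apply: measurable_tnth => //; by rewrite ball_itv; exact: measurable_itv.
by apply/seteqP; split=> t /= h i; [move=> _; exact: h|exact: (h i I)].
Qed.

Lemma measurable_open_rV (O : set 'rV[R]_D) : open O ->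
  measurable [set t : D.-tuple R | O (\row_i tnth t i)].
Proof.
move=> oO.
pose B (qn : 'rV[rat]_D * nat) : set 'rV[R]_D :=
  ball (map_mx ratr qn.1 : 'rV[R]_D) (qn.2.+1%:R^-1).
pose F (qn : 'rV[rat]_D * nat) : set (D.-tuple R) :=
  if `[< B qn `<=` O >] then
    [set t | forall i, ball (ratr (qn.1 ord0 i) : R) (qn.2.+1%:R^-1) (tnth t i)]
  else set0.
rewrite (_ : [set t | _] = \bigcup_qn F qn); last first.
  apply/seteqP; split=> [t /= Ot|t [qn _]]; last first.
    rewrite /F; case: asboolP => // BO h; apply: BO; split; first by rewrite invr_gt0.
    by move=> i j; rewrite !mxE ord1; exact: h.
  have /nbhs_ballP[e /= e0 eO] : nbhs (\row_i tnth t i) O by exact: open_nbhs_nbhs.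
  have [n _ /(_ _ (leqnn n)) ne] : \forall n \near \oo, (n.+1%:R^-1 : R) < e / 2.
    have e20 : 0 < e / 2 by rewrite divr_gt0.
    exact: (near_infty_natSinv_lt (PosNum e20)).
  have n0 : (0 : R) < n.+1%:R^-1 by rewrite invr_gt0.
  have hq i : exists q : rat, ball (ratr q : R) n.+1%:R^-1 (tnth t i).
    have [|q] := @rat_in_itvoo R (tnth t i - n.+1%:R^-1) (tnth t i + n.+1%:R^-1).
      by rewrite ltrBlDr -addrA ltrDl addr_gt0.
    rewrite in_itv/= => /andP[h1 h2]; exists q.
    by rewrite /ball/= ltr_distl; rewrite ltrBlDr h2 -ltrBlDr h1.
  have [q qP] := choice hq.
  exists (\row_i q i, n) => //; rewrite /F; case: asboolP => [_ i|].
    by rewrite /= mxE; exact: qP.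
  move=> nBO; exfalso; apply: nBO => y [_ By]; apply: eO; split=> // i j.
  have b1 : ball (tnth t j) (e / 2) (ratr (q j) : R).
    by apply: (le_ball (ltW ne)); apply: ball_sym; exact: qP.
  have b2 : ball (ratr (q j) : R) (e / 2) (y i j).
    by apply: (le_ball (ltW ne)); have := By i j; rewrite !mxE.
  by rewrite mxE [e]splitr; exact: ball_triangle b1 b2.
apply: countable_bigcupT_measurable => // qn.
by rewrite /F; case: asboolP => _; [exact: measurable_box|exact: measurable0].
Qed.

Lemma measurable_torus_of_tuple : measurable_fun setT torus_of_tuple.
Proof.
apply: (@measurability _ _ _ _ _ _ (@open (torus R D))) => // _ [U oU <-].
by rewrite setTI; exact: measurable_open_rV oU.
Qed.

HB.instance Definition _ :=
  isMeasurableFun.Build _ _ _ _ torus_of_tuple measurable_torus_of_tuple.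

(* Haar measure: the endpoint 1 of the interval used by [uniform_prob] is
   negligible, so [0, 1]^D and the fundamental domain [0, 1)^D have the same
   image measure. *)
Definition torus_lebesgue : probability (torus R D) R :=
  distribution (cube_prob D) torus_of_tuple.

End TorusLebesgue.

Section System.
Variables (R : realType) (D : nat).

Definition torus_coord (theta : torus R D) (i : 'I_D) : R :=
  repr theta ord0 i - (Num.floor (repr theta ord0 i))%:~R.

Definition eucl_norm (a : 'rV[R]_D) : R := Num.sqrt (\sum_i a ord0 i ^+ 2).

Definition torus_dist (x y : torus R D) : R :=
  inf [set eucl_norm (ab.1 - ab.2) | ab in
        [set ab : 'rV[R]_D * 'rV[R]_D | torus_proj ab.1 = x /\ torus_proj ab.2 = y]].

(* Independent of the representative of v, since n is an integer vector. *)
Definition totally_irrational (v : torus R D) : Prop :=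
  forall n : 'rV[int]_D,
    \sum_i torus_coord v i * (n ord0 i)%:~R \is a Num.int -> n = 0.

Definition diophantine (v : torus R D) : Prop :=
  exists c d : R, [/\ 0 < c, 1 < d &
    forall n : nat, (1 <= n)%N -> c * n%:R `^ (- d) <= torus_dist (v *+ n) 0].

Definition tanh (x : R) : R :=
  (expR x - expR (- x)) / (expR x + expR (- x)).

Definition g (theta : torus R D) : R :=
  D%:R^-1 * \sum_i sin (pi * torus_coord theta i).

Definition kappa0 : \bar R :=
  expeR (- \int[torus_lebesgue R D]_theta lne (g theta)%:E)%E.

(* T^D x [0, 1], as a subset of the ambient space T^D x R. *)
Definition phase : set (torus R D * R) := [set p | 0 <= p.2 <= 1].

(* On T^D x R; it maps [phase] into itself when kappa > 0. *)
Definition F (v : torus R D) (kappa : R) (p : torus R D * R) : torus R D * R :=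
  (p.1 + v, tanh (kappa * p.2) * g p.1).

(* At the endpoints x = 0 and x = 1 the two-sided derivative of the smooth
   extension of the fibre map to R is the one-sided derivative on [0, 1];
   [lne] is -oo at 0. *)
Definition lyapunov (v : torus R D) (kappa : R) (N : nat) (p : torus R D * R)
    : \bar R :=
  (N%:R^-1%:E * lne (derive1 (fun x => (iter N (F v kappa) (p.1, x)).2) p.2)%:E)%E.

Definition invariant_measure (v : torus R D) (kappa : R)
    (P : probability (torus R D * R)%type R) : Prop :=
  forall A, measurable A -> A `<=` phase ->
    P (phase `&` F v kappa @^-1` A) = P A.

Definition ergodic (v : torus R D) (kappa : R)
    (P : probability (torus R D * R)%type R) : Prop :=
  forall A, measurable A -> A `<=` phase ->
    phase `&` F v kappa @^-1` A = A -> P A = 0%E \/ P A = 1%E.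

(* A Borel probability measure on T^D x [0, 1] is one on T^D x R for which
   [phase] has full measure; the product sigma-algebra on T^D x R is the Borel
   one, both factors being second countable. *)
Definition physical_measure (v : torus R D) (kappa : R)
    (P : probability (torus R D * R)%type R) : Prop :=
  [/\ P phase = 1%E, invariant_measure v kappa P, ergodic v kappa P &
    exists V : set (torus R D * R),
      [/\ measurable V, V `<=` phase,
          (0 < (torus_lebesgue R D \x lebesgue_measure) V)%E &
          forall f : torus R D * R -> R, {within phase, continuous f} ->
          forall p, V p ->
            n%:R^-1 * \sum_(0 <= l < n) f (iter l (F v kappa) p) @[n --> \oo]
              --> \int[P]_(q in phase) f q]].

Definition prob_expanding (v : torus R D) (kappa : R)
    (P : probability (torus R D * R)%type R) (N : nat) : \bar R :=
  P [set p | phase p /\ (0 < lyapunov v kappa N p)%E].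

End System.

(* Main.v *)
(* The function [g] is even, subadditive and vanishes only at [0], so it serves
   as a distance on the torus, and the Diophantine condition reads
   [g (n v) >= c n ^ (- d)].  Two close approaches of an orbit to [0] are
   therefore far apart in time, and [- ln g] summed over [n] consecutive points
   of an orbit is at most [A n] plus the single largest term.

   The fibre derivative along an orbit is [x_N / x_0] times a product of factors
   [2 y / sinh (2 y)], [y = kappa x_k].  For large [kappa] it exceeds [1] only if
   [x_0] or some [g (theta + k v)] with [k < N] is exponentially small: otherwise
   growth near [x = 0] keeps [kappa x_k >= 4] for half of the times.  An invariant
   probability gives a ball of radius [r] mass [O (r ^ (1 / d))], since many of
   its translates are disjoint.  For a physical measure [x] vanishes only on a
   null set, and pulling [x_0] back along its past bounds the probability that
   it is small.  This is the upper bound.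

   Conversely, an orbit that has just passed exponentially close to the zero of
   [g] expands for [N] steps, and invariant balls have mass at least a power of
   their radius, by integrating a product of Fejer kernels: their characters have
   zero mean because [v] is totally irrational. *)

(* An estimate [K * exp (- b N)] is useful for large [N] only, whereas the theorem starts at
   [N = 1]. Each remaining [N] needs a bound below [1]: an orbit that starts within [kappa ^- N] of
   the zero of [g] has a first derivative factor too small for expansion in [N] steps, and such
   starts have positive probability.

   The section [x = 0] carries invariant probabilities as well; they are excluded because generic
   points of a physical measure fill a set of positive Lebesgue measure. This gives a null set but
   no rate for small [x]. The rate comes from reading [x] as the end of an orbit of arbitrary length
   [m]: the demand on [g] at a past time weakens exponentially with its distance from the end, so
   the failure probabilities form a geometric series bounded independently of [m].

   On the base, invariance of the marginal replaces an exact volume: it yields two-sided power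
   bounds for the mass of balls, and a power of an exponentially small radius is still exponentially
   small. The size of [kappa] is dictated by the gain [ln kappa] per step near [x = 0], which has to
   beat the mean of [- ln g] along an orbit. *)
Require Import Defs.
From HB Require Import structures.
From mathcomp Require Import all_boot all_order all_algebra.
From mathcomp Require Import all_classical all_reals all_analysis.
From mathcomp Require Import measurable_realfun ring lra.

Set Implicit Arguments.
Unset Strict Implicit.
Unset Printing Implicit Defensive.

Import Order.TTheory GRing.Theory Num.Theory.
Import numFieldNormedType.Exports.

Local Open Scope classical_set_scope.
Local Open Scope ring_scope.

(** * Distances on the torus *)

Section Trig.
Variable R : realType.
Implicit Types x y : R.

Lemma sin_pi_addz x (z : int) :
  `|sin (pi * (x + z%:~R))| = `|sin (pi * x)|.
Proof.
have H y (n : nat) : `|sin (y + pi *+ n)| = `|sin y|.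
  elim: n => [|n IH]; first by rewrite mulr0n addr0.
  by rewrite mulrSr addrA sinDpi normrN.
rewrite mulrDr; case: z => n.
  by rewrite -[(Posz n)%:~R]/(n%:R) mulr_natr H.
rewrite NegzE mulrNz mulrN -[(n.+1)%:~R]/(n.+1%:R) mulr_natr.
by rewrite -(H _ n.+1) subrK.
Qed.

Lemma cos_2pi_addz x (z : int) :
  cos (2 * pi * (x + z%:~R)) = cos (2 * pi * x).
Proof.
have e y : 2 * pi * y = (pi * y) *+ 2 by rewrite mulr2n; ring.
rewrite !e !cos_mulr2n; congr (_ - 1); congr (_ *+ 2).
by rewrite !cos2sin2 -real_normK ?num_real// sin_pi_addz real_normK ?num_real.
Qed.

Lemma sin_2pi_addz x (z : int) :
  sin (2 * pi * (x + z%:~R)) = sin (2 * pi * x).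
Proof.
have e y : sin (2 * pi * y) = - cos (2 * pi * (y + 4^-1)).
  by rewrite (_ : 2 * pi * (y + 4^-1) = 2 * pi * y + pi / 2) ?cosDpihalf ?opprK//; field.
by rewrite !e addrAC cos_2pi_addz.
Qed.

Lemma cos_2pi_eq1 x : cos (2 * pi * x) = 1 -> x \is a Num.int.
Proof.
rewrite (_ : 2 * pi * x = (pi * x) *+ 2); last by rewrite mulr2n; ring.
rewrite cos_mulr2n cos2sin2 => h.
have h2 : sin (pi * x) ^+ 2 = 0.
  by move: h; rewrite mulr2n; lra.
have /eqP h3 : `|sin (pi * x)| == 0 by rewrite normr_eq0 -sqrf_eq0 h2.
have := sin_pi_addz x (- Num.floor x); rewrite h3 mulrNz.
set f := x - _ => /eqP; rewrite normr_eq0 => /eqP h4.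
have f0 : 0 <= f by rewrite subr_ge0 floor_le.
have f1 : f < 1 by have := floorD1_gt x; rewrite intrD /f; lra.
move: f0; rewrite le_eqVlt => /orP[/eqP f0|f0].
  by rewrite -[x](subrK (Num.floor x)%:~R) -/f -f0 add0r intr_int.
have : 0 < sin (pi * f).
  apply: sin_gt0_pi; rewrite mulr_gt0 ?pi_gt0//=.
  by rewrite gtr_pMr ?pi_gt0.
by rewrite h4 ltxx.
Qed.

Lemma norm_sinD x y : `|sin (x + y)| <= `|sin x| + `|sin y|.
Proof.
rewrite sinD (le_trans (ler_normD _ _))// !normrM lerD//.
  by rewrite ler_piMr// cos_max.
by rewrite ler_piMl// cos_max.
Qed.

(* The double angle formula turns the mean value bound
   [sin (y/2) >= (y/2) cos (y/2)] into [sin y >= y cos^2 (y/2)]. *)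
Lemma sin_ge_half y : 0 <= y <= pi / 2 -> y / 2 <= sin y.
Proof.
case/andP=> y0 y1.
have [->|yn0] := eqVneq y 0; first by rewrite mul0r sin0.
have ygt0 : 0 < y by rewrite lt_neqAle eq_sym yn0.
set z := y / 2.
have z0 : 0 < z by rewrite /z divr_gt0.
have zp : z <= pi / 4 by rewrite /z; lra.
have ez : y = z *+ 2 by rewrite /z mulr2n; field.
have pi0 := pi_gt0 R.
have mono u : 0 <= u <= z -> cos z <= cos u.
  case/andP=> u0 uz.
  have [->//|uz'] := eqVneq u z.
  rewrite ltW// ltr_cos ?in_itv/=.
  - by rewrite lt_neqAle uz'.
  - by apply/andP; split; lra.
  - by apply/andP; split; lra.
have [c cin hc] : exists2 c, c \in `]0, z[ & sin z - sin 0 = cos c * (z - 0).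
  apply: (@MVT _ (@sin R) (@cos R)) => //.
  by apply: continuous_subspaceT; exact: continuous_sin.
move: hc; rewrite sin0 !subr0 => hc.
have cz : cos z <= cos c.
  by apply: mono; move: cin; rewrite in_itv/= => /andP[/ltW-> /ltW->].
have cz2 : 2^-1 <= cos z ^+ 2.
  have : 0 <= cos y by apply: cos_ge0_pihalf; rewrite y1 andbT; lra.
  by rewrite ez cos_mulr2n mulr2n; lra.
have cz0 : 0 <= cos z by apply: cos_ge0_pihalf; lra.
rewrite ez sin_mulr2n mulr2n hc.
have h : z * cos z ^+ 2 <= cos z * (cos c * z).
  by rewrite expr2 mulrCA [cos c * z]mulrC !ler_wpM2l// ltW.
have : z * 2^-1 <= z * cos z ^+ 2 by rewrite ler_wpM2l// ltW.
by rewrite -mulr2n; lra.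
Qed.

(** Since [pi >= 2], the factor [1 / 2] lost in [sin_ge_half] is recovered. *)
Lemma norm_le_norm_sin_pi x : `|x| <= 2^-1 -> `|x| <= `|sin (pi * x)|.
Proof.
move=> hx; have pi2 := pi_ge2 R.
have h : 0 <= pi * `|x| <= pi / 2.
  by rewrite mulr_ge0 ?pi_ge0//= ler_wpM2l ?pi_ge0.
have -> : `|sin (pi * x)| = `|sin (pi * `|x|)|.
  have [x0|x0] := leP 0 x; first by rewrite (ger0_norm x0).
  by rewrite (ltr0_norm x0) mulrN sinN normrN.
apply: le_trans (ler_norm _); apply: le_trans (sin_ge_half h).
by rewrite mulrAC ler_peMl//; lra.
Qed.

End Trig.

Section TorusBasics.
Variables (R : realType) (D : nat).
Implicit Types (a b : 'rV[R]_D) (t u : torus R D).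

Lemma torus_proj_eq a b :
  (torus_proj a = torus_proj b) <-> a - b \is a mxOver Num.int.
Proof.
have e : (a - b \is a mxOver Num.int) = (torus_proj a == torus_proj b).
  exact: (@Quotient.idealrBE _ (GRing.ZmodClosed.clone _ (@lattice R D) _) a b).
by rewrite e; split=> /eqP.
Qed.

Lemma torus_projD a b : torus_proj (a + b) = torus_proj a + torus_proj b.
Proof. by rewrite /torus_proj; exact: raddfD. Qed.

Lemma torus_projN a : torus_proj (- a) = - torus_proj a.
Proof. by rewrite /torus_proj; exact: raddfN. Qed.

Lemma torus_proj0 : torus_proj (0 : 'rV[R]_D) = 0.
Proof. by rewrite /torus_proj; exact: raddf0. Qed.

Lemma torus_reprK t : torus_proj (repr t) = t.
Proof. exact: reprK. Qed.

Lemma torus_proj_surj t : exists a, t = torus_proj a.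
Proof. by exists (repr t); rewrite torus_reprK. Qed.

Lemma torus_coord_proj a i :
  exists z : int, torus_coord (torus_proj a) i = a ord0 i + z%:~R.
Proof.
have /torus_proj_eq/mxOverP/(_ ord0 i) := torus_reprK (torus_proj a).
rewrite !mxE => /intrP[z hz].
exists (z - Num.floor (repr (torus_proj a) ord0 i)).
by rewrite /torus_coord intrD mulrNz -hz; ring.
Qed.

Lemma torus_coord_itv t i : 0 <= torus_coord t i < 1.
Proof.
rewrite /torus_coord subr_ge0 floor_le/=.
by have := floorD1_gt (repr t ord0 i); rewrite intrD; lra.
Qed.

Lemma norm_sin_coord a i :
  `|sin (pi * torus_coord (torus_proj a) i)| = `|sin (pi * a ord0 i)|.
Proof. by have [z ->] := torus_coord_proj a i; rewrite sin_pi_addz. Qed.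

(** The coordinates lie in [[0, 1)], where these sines are non-negative. With absolute values each
    summand has period [1], so [g] can be computed from any representative. *)
Lemma gE t : g t = D%:R^-1 * \sum_i `|sin (pi * torus_coord t i)|.
Proof.
congr (_ * _); apply: eq_bigr => i _; rewrite ger0_norm//.
have /andP[h0 h1] := torus_coord_itv t i.
by apply: sin_ge0_pi; rewrite mulr_ge0 ?pi_ge0//= ler_piMr ?pi_ge0// ltW.
Qed.

Lemma g_proj a : g (torus_proj a) = D%:R^-1 * \sum_i `|sin (pi * a ord0 i)|.
Proof. by rewrite gE; congr (_ * _); apply: eq_bigr => i _; rewrite norm_sin_coord. Qed.

Lemma g_ge0 t : 0 <= g t.
Proof. by rewrite gE mulr_ge0// sumr_ge0. Qed.

Lemma g_le1 t : g t <= 1.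
Proof.
rewrite gE; case: D t => [t|n t]; first by rewrite invr0 mul0r.
rewrite mulrC ler_pdivrMr// mul1r.
apply: le_trans (_ : \sum_(i < n.+1) 1 <= _).
  by apply: ler_sum => i _; exact: sin_max.
by rewrite sumr_const card_ord.
Qed.

Lemma g0 : g (0 : torus R D) = 0.
Proof.
rewrite -torus_proj0 g_proj big1 ?mulr0// => i _.
by rewrite mxE mulr0 sin0 normr0.
Qed.

Lemma gN t : g (- t) = g t.
Proof.
have [a ->] := torus_proj_surj t; rewrite -torus_projN !g_proj.
by congr (_ * _); apply: eq_bigr => i _; rewrite mxE mulrN sinN normrN.
Qed.

Lemma gD t u : g (t + u) <= g t + g u.
Proof.
have [a ->] := torus_proj_surj t; have [b ->] := torus_proj_surj u.
rewrite -torus_projD !g_proj -mulrDr ler_wpM2l// -big_split/=.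
by apply: ler_sum => i _; rewrite mxE mulrDr; exact: norm_sinD.
Qed.

Lemma gB t u : g (t - u) <= g t + g u.
Proof. by rewrite -[g u]gN; exact: gD. Qed.

Lemma measurable_torus_fun (f : torus R D -> R) :
  continuous (f \o @torus_proj R D) -> measurable_fun setT f.
Proof.
move=> cf; apply: (measurability _ (RGenOInfty.measurableE R)) => _ [_ [x ->] <-].
have oU : open `]x, +oo[%classic by exact: interval_open.
rewrite setTI; apply: sub_sigma_algebra; move: oU; set U := (X in open X) => oU.
rewrite /= (_ : open _ = torus_open (f @^-1` U))//.
by rewrite /torus_open -comp_preimage; move/continuousP: cf; apply.
Qed.

Lemma continuous_sum (T : topologicalType) (I : Type) (r : seq I)
    (f : I -> T -> R) :
  (forall i, continuous (f i)) -> continuous (fun x => \sum_(i <- r) f i x).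
Proof.
move=> cf; elim: r => [|i r IH].
  have -> : (fun x => \sum_(i <- [::]) f i x) = cst 0.
    by apply/funext => y; rewrite big_nil.
  by move=> x; exact: cvg_cst.
have -> : (fun x => \sum_(j <- i :: r) f j x) =
    (fun y => f i y + \sum_(j <- r) f j y).
  by apply/funext => y; rewrite big_cons.
by move=> x; apply: cvgD; [exact: cf|exact: IH].
Qed.

Lemma continuous_cmul (T : topologicalType) (c : R) (f : T -> R) :
  continuous f -> continuous (fun x => c * f x).
Proof. move=> cf x; exact: (cvgM (cvg_cst c) (cf x)). Qed.

Lemma continuous_compose (T U V : topologicalType) (f : T -> U) (h : U -> V) :
  continuous f -> continuous h -> continuous (fun x => h (f x)).
Proof. by move=> cf ch x; apply: continuous_comp; [exact: cf|exact: ch]. Qed.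

Lemma continuous_entry (i : 'I_D) : continuous (fun a : 'rV[R]_D => a ord0 i).
Proof. exact: coord_continuous. Qed.

Lemma measurable_g : measurable_fun setT (@g R D).
Proof.
apply: measurable_torus_fun.
rewrite (_ : _ \o _ = fun a => D%:R^-1 * \sum_i `|sin (pi * a ord0 i)|); last first.
  by apply/funext => a /=; rewrite g_proj.
apply: continuous_cmul; apply: continuous_sum => i.
apply: (continuous_compose _ (@norm_continuous _ R)).
apply: (continuous_compose _ (@continuous_sin R)).
by apply: continuous_cmul; exact: continuous_entry.
Qed.

Lemma measurable_torus_addr u : measurable_fun setT (fun t : torus R D => t + u).
Proof.
apply: (@measurability _ _ _ _ _ _ (@open (torus R D))) => //.
move=> _ [U oU <-]; rewrite setTI; apply: sub_sigma_algebra.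
have [b bE] := torus_proj_surj u.
rewrite /= (_ : open _ = torus_open ((fun t => t + u) @^-1` U))//.
rewrite /torus_open (_ : _ @^-1` _ = (fun a => a + b) @^-1` (@torus_proj R D @^-1` U)).
  have ca : continuous (fun a : 'rV[R]_D => a + b).
    move=> a A [P hP sP].
    exists (fun i j => [set x | P i j (x + b i j)]) => [i j|M hM].
      have cx : (x : R^o) + b i j @[x --> (a i j : R^o)] --> a i j + b i j.
        by apply: cvgD; [exact: cvg_id|exact: cvg_cst].
      by apply: cx; have := hP i j; rewrite mxE.
    by apply: sP => i j; rewrite mxE; exact: hM.
  by move/continuousP: ca; apply; exact: oU.
by apply/funext => a /=; rewrite torus_projD bE.
Qed.

(** Subtracting nearest integers gives a representative with entries in [[-1/2, 1/2]]. Its Euclidean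
    norm is at most its l1 norm, which [norm_le_norm_sin_pi] compares with [g] entry by entry. *)
Lemma torus_dist_g t : (0 < D)%N -> torus_dist t 0 <= D%:R * g t.
Proof.
move=> D0.
have [b tE] := torus_proj_surj t.
pose a := \row_i (b ord0 i - (Num.floor (b ord0 i + 2^-1))%:~R).
have ha i : `|a ord0 i| <= 2^-1.
  rewrite mxE ler_norml.
  have := floor_le (b ord0 i + 2^-1); have := floorD1_gt (b ord0 i + 2^-1).
  by rewrite intrD; lra.
have aE : torus_proj a = t.
  rewrite tE; apply/torus_proj_eq/mxOverP => i j; rewrite !mxE !ord1.
  by rewrite addrAC subrr add0r rpredN intr_int.
apply: (@le_trans _ _ (eucl_norm a)).
  apply: ge_inf; last first.
    by exists (a, 0) => /=; rewrite ?subr0// aE torus_proj0.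
  by exists 0 => _ [ab _ <-]; exact: sqrtr_ge0.
rewrite -aE g_proj mulrA divff ?mul1r ?pnatr_eq0 -?lt0n//.
have h1 : eucl_norm a <= \sum_i `|a ord0 i|.
  rewrite /eucl_norm -[leRHS]ger0_norm ?sumr_ge0// -sqrtr_sqr ler_sqrt ?sqr_ge0//.
  have : 0 <= \sum_i `|a ord0 i| /\
      \sum_i a ord0 i ^+ 2 <= (\sum_i `|a ord0 i|) ^+ 2; last by case.
  elim/big_ind2 : _ => [|x1 x2 y1 y2 [h1 h2] [h3 h4]|i _].
  - by rewrite expr0n.
  - by split; [exact: addr_ge0|have := mulr_ge0 h1 h3; rewrite sqrrD mulr2n; lra].
  - by rewrite real_normK ?num_real.
apply: le_trans h1 _; apply: ler_sum => i _.
exact: norm_le_norm_sin_pi.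
Qed.

End TorusBasics.

(** * Sums of [- ln g] along orbits *)

Section Gaps.
Variable R : realType.

(** The gaps between consecutive members of [Q] add up to the position of the last one. As [0] is a
    member, every member counted from [1] on pays for a gap of its own, and no additive error
    remains. *)
Lemma count_separated (Q : pred nat) (G : R) (n : nat) :
  Q 0%N -> (forall k k', (k < k')%N -> Q k -> Q k' -> G <= (k' - k)%:R) ->
  G * \sum_(1 <= k < n.+1) (Q k)%:R <= n%:R.
Proof.
move=> Q0 sepQ.
suff [l [ln Ql hl]] : exists l, [/\ (l <= n)%N, Q l &
    G * \sum_(1 <= k < n.+1) (Q k)%:R <= l%:R].
  by apply: le_trans hl _; rewrite ler_nat.
elim: n => [|n [l [ln Ql hl]]].
  by exists 0%N; rewrite big_geq// mulr0.
rewrite big_nat_recr//=; have [Qn|nQn] := boolP (Q n.+1); last first.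
  by exists l; split=> //; [exact: leqW|rewrite addr0].
exists n.+1; split=> //; rewrite mulrDr mulr1.
have := sepQ l n.+1 ln Ql Qn; rewrite natrB ?leqW//; lra.
Qed.

(** If [2^-(k+1) <= y < 2^-k], the levels [0, ..., k] are counted and [- ln y <= (k+1) ln 2]; the
    lower bound on [y] makes [J] levels suffice. *)
Lemma ln_layer_cake (y : R) (J : nat) : 0 < y -> 2^-1 ^+ J <= y ->
  - ln y <= ln 2 * \sum_(j < J) (y < 2^-1 ^+ j)%R%:R.
Proof.
move=> y0; have ln2 : 0 < ln 2 :> R by rewrite ln_gt0// ltr1n.
elim: J => [|J IH] hJ.
  by rewrite big_ord0 mulr0 oppr_le0 ln_ge0// -(expr0 2^-1).
have [h|h] := leP (2^-1 ^+ J) y.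
  apply: le_trans (IH h) _; rewrite ler_wpM2l ?(ltW ln2)//.
  by rewrite big_ord_recr/= lerDl.
rewrite (eq_bigr (fun=> 1)) => [|j _].
  rewrite sumr_const card_ord mulr_natr.
  have : ln (2^-1 ^+ J.+1) <= ln y :> R.
    by rewrite ler_ln ?posrE// exprn_gt0 ?invr_gt0.
  by rewrite lnXn ?invr_gt0// lnV ?posrE// mulNrn; lra.
rewrite (lt_le_trans h)//; apply: ler_wiXn2l; rewrite ?invr_ge0 ?invf_le1 ?ler1n//.
by rewrite -ltnS ltn_ord.
Qed.

Lemma geometric_sum_le (r : R) (J : nat) : 0 <= r < 1 ->
  \sum_(j < J) r ^+ j <= (1 - r)^-1.
Proof.
case/andP=> r0 r1; rewrite -[leRHS]mul1r ler_pdivlMr ?subr_gt0//.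
have := subrX1 r J; have := exprn_ge0 J r0.
set S := \sum_(i < J) _; set X := r ^+ J; nra.
Qed.

(** Two times with [a < 2^-j] are separated by a gap that grows like [2^(j/d)], so there are
    [O(n 2^(-j/d))] of them up to [n], and summing over the levels [j] of the layer cake gives a
    geometric series. As [a 0 = 0], the origin is itself a close approach, which is why no term for
    a largest summand appears. *)
Lemma sum_ln_diophantine (a : nat -> R) (c d : R) : 0 < c -> 1 < d ->
  a 0%N = 0 ->
  (forall n, (1 <= n)%N -> c * n%:R `^ (- d) <= a n) ->
  (forall k k', (k <= k')%N -> a (k' - k)%N <= a k + a k') ->
  exists2 C, 0 <= C &
    forall n, \sum_(1 <= j < n.+1) - ln (a j) <= C * n%:R.
Proof.
move=> c0 d1 a0 ha sub.
have d0 : 0 < d by rewrite (lt_trans _ d1).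
have apos n : (1 <= n)%N -> 0 < a n.
  by move=> n1; apply: lt_le_trans (ha n n1); rewrite mulr_gt0// powR_gt0// ltr0n.
(* A gap [m] between two such times satisfies [c m^-d < 2 * 2^-j], that is [m > B * tau ^ j]. *)
pose tau : R := 2 `^ d^-1; pose B : R := (c / 2) `^ d^-1.
have B0 : 0 < B by rewrite powR_gt0// divr_gt0.
have tau1 : 1 < tau.
  by rewrite /tau /powR pnatr_eq0/= expR_gt1 mulr_gt0 ?invr_gt0// ln_gt0 ?ltr1n.
have tau0 : 0 < tau by rewrite (lt_trans _ tau1).
have ln2 : 0 < ln 2 :> R by rewrite ln_gt0// ltr1n.
have cnt n j : \sum_(1 <= k < n.+1) (a k < 2^-1 ^+ j)%R%:R <= n%:R * (B^-1 * tau^-1 ^+ j).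
  rewrite (exprVn tau) -invfM ler_pdivlMr ?mulr_gt0 ?exprn_gt0// mulrC.
  apply: count_separated; first by rewrite a0 exprn_gt0 ?invr_gt0.
  move=> k k' kk' hk hk'.
  have m0 : (0 < k' - k)%N by rewrite subn_gt0.
  set m := (k' - k)%N in m0 *.
  have m0R : 0 < m%:R :> R by rewrite ltr0n.
  have h : c * m%:R `^ (- d) < 2 * 2^-1 ^+ j.
    apply: le_lt_trans (ha _ m0) _; apply: le_lt_trans (sub _ _ (ltnW kk')) _.
    by lra.
  have h2 : c / 2 * 2 ^+ j < m%:R `^ d.
    move: h; rewrite powRN ltr_pdivrMr ?powR_gt0// exprVn mulrAC ltr_pdivlMr ?exprn_gt0//.
    by lra.
  have -> : B * tau ^+ j = (c / 2 * 2 ^+ j) `^ d^-1.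
    rewrite powRM ?divr_ge0 ?exprn_ge0 ?(ltW c0)//; congr (_ * _).
    by rewrite -powR_mulrn ?powR_ge0// -powRrM -(powR_mulrn j (ler0n R 2)) -powRrM mulrC.
  have -> : m%:R = (m%:R `^ d) `^ d^-1 :> R.
    by rewrite -powRrM divff ?gt_eqF// powRr1// ltW.
  apply: ge0_ler_powR; rewrite ?nnegrE ?invr_ge0 ?powR_ge0 ?(ltW d0) ?(ltW h2)//.
  by rewrite mulr_ge0 ?exprn_ge0// divr_ge0// ltW.
exists (ln 2 * (B^-1 * (1 - tau^-1)^-1)).
  rewrite !mulr_ge0 ?invr_ge0 ?(ltW ln2) ?(ltW B0)// subr_ge0.
  by rewrite invf_le1// ltW.
move=> n.
(* [J] depends on [n], but it only truncates a geometric series whose bound does not involve it. *)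
have [J hJ] : exists J, forall k, (1 <= k < n.+1)%N -> 2^-1 ^+ J <= a k.
  elim: n => [|n [J hJ]].
    by exists 0%N => k; rewrite ltnS; case: k.
  have [K hK] : exists K, 2^-1 ^+ K <= a n.+1.
    have [K _ /(_ K (leqnn K))] : \forall K \near \oo, `|2^-1 ^+ K : R| < a n.+1.
      by apply: cvgr0_norm_lt; [apply: cvg_expr; rewrite ger0_norm// invf_lt1// ltr1n|exact: apos].
    by rewrite ger0_norm ?exprn_ge0 ?invr_ge0// => /ltW; exists K.
  exists (maxn J K) => k /andP[k1 kn].
  have mono u w : (u <= w)%N -> (2^-1 : R) ^+ w <= 2^-1 ^+ u.
    by move=> uw; apply: ler_wiXn2l => //; rewrite ?invr_ge0 ?invf_le1 ?ler1n.
  move: kn; rewrite ltnS leq_eqVlt => /orP[/eqP->|kn].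
    by apply: le_trans hK; apply: mono; rewrite leq_maxr.
  by apply: le_trans (hJ k _); [apply: mono; rewrite leq_maxl|rewrite k1].
apply: (@le_trans _ _ (\sum_(1 <= k < n.+1) ln 2 * \sum_(j < J) (a k < 2^-1 ^+ j)%R%:R)).
  rewrite [leLHS]big_nat_cond [leRHS]big_nat_cond.
  apply: ler_sum => k /andP[hk _]; apply: ln_layer_cake; last exact: hJ.
  by case/andP: hk => k1 _; exact: apos.
rewrite -mulr_sumr -!mulrA ler_wpM2l ?(ltW ln2)// exchange_big/=.
apply: (@le_trans _ _ (\sum_(j < J) n%:R * (B^-1 * tau^-1 ^+ j))).
  by apply: ler_sum => j _; exact: cnt.
rewrite -mulr_sumr -mulr_sumr [leLHS]mulrCA ler_wpM2l ?invr_ge0 ?(ltW B0)//.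
rewrite [leRHS]mulrC ler_wpM2l//; apply: geometric_sum_le.
by rewrite invr_ge0 (ltW tau0)/= invf_lt1.
Qed.
End Gaps.

Section Orbit.
Variables (R : realType) (D : nat) (v : torus R D).
Implicit Types t : torus R D.

Lemma g_mulrn_sub k k' : (k <= k')%N ->
  g (v *+ (k' - k)) <= g (v *+ k) + g (v *+ k').
Proof. by move=> kk'; rewrite mulrnBr// [leRHS]addrC; exact: gB. Qed.

Lemma g_diophantine : (0 < D)%N -> diophantine v ->
  exists c d : R, [/\ 0 < c, 1 < d &
    forall n, (1 <= n)%N -> c * n%:R `^ (- d) <= g (v *+ n)].
Proof.
move=> D0 [c [d [c0 d1 h]]]; exists (c / D%:R), d; split=> //.
  by rewrite divr_gt0// ltr0n.
move=> n n1; rewrite mulrAC ler_pdivrMr ?ltr0n// [leRHS]mulrC.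
by apply: le_trans (h n n1) _; exact: torus_dist_g.
Qed.

Variables (C : R) (C0 : 0 <= C).
Hypothesis gv_gt0 : forall n, (1 <= n)%N -> 0 < g (v *+ n).
Hypothesis sumC : forall n, \sum_(1 <= j < n.+1) - ln (g (v *+ j)) <= C * n%:R.

(* Away from its closest approach to the zero of [g], the orbit of [t] is
   compared with the orbit of the zero itself by subadditivity. *)
Lemma sum_ln_orbit t n M : 0 <= M ->
  (forall k, (k < n)%N -> expR (- M) <= g (t + v *+ k)) ->
  \sum_(0 <= k < n) - ln (g (t + v *+ k)) <= (C + ln 2) * n%:R + M.
Proof.
move=> M0; case: n => [|n] hM.
  by rewrite big_geq// mulr0 add0r.
pose F (k : nat) := g (t + v *+ k).
have Fpos k : (k < n.+1)%N -> 0 < F k.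
  by move=> kn; apply: lt_le_trans (hM k kn); exact: expR_gt0.
have [i _ imin] := @arg_minP _ R 'I_n.+1 ord0 xpredT (fun k => F k) isT.
have ln2 : 0 < ln 2 :> R by rewrite ln_gt0// ltr1n.
(* As [F i <= F k] at the closest approach [i], subadditivity gives [g (v *+ m) <= 2 * F k]: this is
   the [ln 2] in the rate. *)
have hF k m : (k < n.+1)%N -> (0 < m)%N -> g (v *+ m) <= F k + F i ->
    - ln (F k) <= ln 2 - ln (g (v *+ m)).
  move=> kn m0 h.
  have h' : F i <= F k by exact: (imin (Ordinal kn) isT).
  have : ln (g (v *+ m)) <= ln (2 * F k).
    rewrite ler_ln ?posrE; [by lra|exact: gv_gt0|].
    by rewrite mulr_gt0// Fpos.
  by rewrite lnM ?posrE ?Fpos//; lra.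
have ltin := ltn_ord i.
rewrite (@big_cat_nat _ _ _ i)//=; last exact: ltnW.
rewrite (big_ltn ltin)/=.
have h1 : \sum_(0 <= k < i) - ln (F k) <= (C + ln 2) * i%:R.
  apply: (@le_trans _ _ (\sum_(0 <= k < i) (ln 2 - ln (g (v *+ (i - k)))))).
    rewrite [leLHS]big_nat_cond [leRHS]big_nat_cond.
    apply: ler_sum => k /andP[/andP[_ ki] _]; apply: hF.
    - exact: ltn_trans ki ltin.
    - by rewrite subn_gt0.
    - rewrite (_ : v *+ (i - k) = (t + v *+ i) - (t + v *+ k)).
        by rewrite [leRHS]addrC; exact: gB.
      by rewrite mulrnBr 1?ltnW// opprD addrACA subrr add0r.
  rewrite big_split/= sumr_const_nat subn0 mulrDl [leRHS]addrC.
  rewrite mulr_natr lerD2l.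
  rewrite big_nat_rev/= add0n; apply: le_trans (sumC i).
  rewrite big_add1/= [leLHS]big_nat_cond [leRHS]big_nat_cond le_eqVlt; apply/orP; left; apply/eqP.
  by apply: eq_bigr => k /andP[/andP[_ ki] _]; rewrite subKn.
have h2 : \sum_(i.+1 <= k < n.+1) - ln (F k) <= (C + ln 2) * (n - i)%:R.
  apply: (@le_trans _ _ (\sum_(i.+1 <= k < n.+1) (ln 2 - ln (g (v *+ (k - i)))))).
    rewrite [leLHS]big_nat_cond [leRHS]big_nat_cond.
    apply: ler_sum => k /andP[/andP[ik kn] _]; apply: hF => //.
    - by rewrite subn_gt0.
    - rewrite (_ : v *+ (k - i) = (t + v *+ k) - (t + v *+ i)); first exact: gB.
      by rewrite mulrnBr 1?ltnW// opprD addrACA subrr add0r.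
  rewrite big_split/= sumr_const_nat subSS mulrDl [leRHS]addrC.
  rewrite mulr_natr lerD2l; apply: le_trans (sumC (n - i)).
  rewrite -[i.+1]add1n big_addn subSn// le_eqVlt; apply/orP; left; apply/eqP.
  by apply: eq_bigr => k _; rewrite addnK.
have h3 : - ln (F i) <= M.
  by rewrite lerNl -[leLHS]expRK ler_ln ?posrE ?expR_gt0 ?Fpos// hM.
have h4 : (C + ln 2) * n.+1%:R = (C + ln 2) * i%:R + (C + ln 2) * (n - i)%:R + (C + ln 2).
  by rewrite -!mulrDr -natrD subnKC -1?ltnS// -[n.+1]addn1 natrD mulrDr mulr1.
apply: le_trans (lerD h1 (lerD h3 h2)) _; rewrite h4.
by set a := _ * i%:R; set b := _ * (n - i)%:R; have := addr_ge0 C0 (ltW ln2); set e := C + ln 2; lra.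
Qed.

End Orbit.

(** * Invariant probabilities on the torus *)

Section BoundedIntegral.
Context d (T : measurableType d) (R : realType) (m : probability T R).
Implicit Types f h : T -> R.

(** Closed under sums and products, and integrable for every probability: this settles the
    integrability of all trigonometric polynomials below. *)
Definition bounded_mfun f :=
  measurable_fun setT f /\ exists M, forall t, `|f t| <= M.

Lemma bounded_mfun_integrable f : bounded_mfun f -> m.-integrable setT (EFin \o f).
Proof.
move=> [mf [M hM]]; apply: measurable_bounded_integrable => //.
  by rewrite ltey_eq fin_num_measure.
exists M; split; first exact: num_real.
by move=> N MN x _; exact: le_trans (hM x) (ltW MN).
Qed.

Lemma bounded_mfun_cst c : bounded_mfun (cst c).
Proof. by split; [exact: measurable_cst|exists `|c|]. Qed.

Lemma bounded_mfunD f h : bounded_mfun f -> bounded_mfun h ->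
  bounded_mfun (fun t => f t + h t).
Proof.
move=> [mf [M hM]] [mh [N hN]]; split; first exact: measurable_funD.
by exists (M + N) => t; rewrite (le_trans (ler_normD _ _))// lerD.
Qed.

Lemma bounded_mfunM f h : bounded_mfun f -> bounded_mfun h ->
  bounded_mfun (fun t => f t * h t).
Proof.
move=> [mf [M hM]] [mh [N hN]]; split; first exact: measurable_funM.
by exists (M * N) => t; rewrite normrM ler_pM.
Qed.

Lemma bounded_mfun_sum (I : Type) (r : seq I) (f : I -> T -> R) :
  (forall i, bounded_mfun (f i)) -> bounded_mfun (fun t => \sum_(i <- r) f i t).
Proof.
move=> hf; elim: r => [|i r IH].
  rewrite (_ : (fun t => _) = cst 0); first exact: bounded_mfun_cst.
  by apply/funext => t; rewrite big_nil.
rewrite (_ : (fun t => _) = fun t => f i t + \sum_(j <- r) f j t).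
  exact: bounded_mfunD.
by apply/funext => t; rewrite big_cons.
Qed.

Lemma bounded_mfun_prod (I : Type) (r : seq I) (f : I -> T -> R) :
  (forall i, bounded_mfun (f i)) -> bounded_mfun (fun t => \prod_(i <- r) f i t).
Proof.
move=> hf; elim: r => [|i r IH].
  rewrite (_ : (fun t => _) = cst 1); first exact: bounded_mfun_cst.
  by apply/funext => t; rewrite big_nil.
rewrite (_ : (fun t => _) = fun t => f i t * \prod_(j <- r) f j t).
  exact: bounded_mfunM.
by apply/funext => t; rewrite big_cons.
Qed.

Lemma bounded_mfun_indic (A : set T) : measurable A -> bounded_mfun \1_A.
Proof.
move=> mA; split; first exact: measurable_indic.
by exists 1 => t; rewrite indicE; case: (_ \in _); rewrite ?normr1 ?normr0.
Qed.

Lemma integral_prob_sum (I : Type) (r : seq I) (f : I -> T -> R) :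
  (forall i, bounded_mfun (f i)) ->
  \int[m]_t (\sum_(i <- r) f i t) = \sum_(i <- r) \int[m]_t f i t.
Proof.
move=> hf; elim: r => [|i r IH].
  rewrite big_nil -[RHS](mul0r (fine (m setT))) -Rintegral_cst//.
  by apply: eq_Rintegral => t _; rewrite big_nil.
rewrite big_cons -IH -RintegralD//; try exact: bounded_mfun_integrable.
  by apply: eq_Rintegral => t _; rewrite big_cons.
by apply: bounded_mfun_integrable; exact: bounded_mfun_sum.
Qed.

Lemma fine_prob (A : set T) : measurable A -> m A = (fine (m A))%:E.
Proof. by move=> mA; rewrite fineK// fin_num_measure. Qed.

Lemma Rintegral_indicT (A : set T) : measurable A ->
  \int[m]_t \1_A t = fine (m A).
Proof. by move=> mA; rewrite /Rintegral integral_indic// setIT. Qed.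

Lemma Rintegral_preserved (phi : T -> T) f :
  measurable_fun setT phi ->
  (forall A, measurable A -> m (phi @^-1` A) = m A) ->
  bounded_mfun f -> \int[m]_t f (phi t) = \int[m]_t f t.
Proof.
move=> mphi hphi [mf [M hM]].
have bf : bounded_mfun (f \o phi).
  by split; [exact: measurableT_comp|exists M => t; exact: hM].
rewrite /Rintegral; congr fine.
rewrite -(@integral_pushforward _ _ _ _ _ _ mphi m setT (EFin \o f))//.
- by apply: eq_measure_integral => A mA _; first [exact: hphi | exact/esym/hphi].
- exact/measurable_EFinP.
- by rewrite preimage_setT; exact: bounded_mfun_integrable.
Qed.

End BoundedIntegral.

(** * Fejer kernels *)

Section FejerKernel.
Variable R : realType.
Implicit Types (x : R) (K : nat).

(** This is the square of the modulus of [sum_(a < K) e^(2 pi i a x)], or [K] times the usual Fejer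
    kernel; the double sum displays its frequencies [a - b]. *)
Definition fejer K x : R :=
  \sum_(a < K) \sum_(b < K) cos (2 * pi * (a%:R - b%:R) * x).

Lemma fejerE K x : fejer K x =
  (\sum_(a < K) cos (2 * pi * a%:R * x)) ^+ 2 + (\sum_(a < K) sin (2 * pi * a%:R * x)) ^+ 2.
Proof.
rewrite /fejer !expr2 !mulr_suml -big_split/=; apply: eq_bigr => a _.
rewrite !mulr_sumr -big_split/=; apply: eq_bigr => b _.
by rewrite -cosB; congr cos; ring.
Qed.

Lemma fejer_ge0 K x : 0 <= fejer K x.
Proof. by rewrite fejerE addr_ge0// sqr_ge0. Qed.

Lemma fejer_le K x : fejer K x <= K%:R ^+ 2.
Proof.
apply: (@le_trans _ _ (\sum_(a < K) \sum_(b < K) 1)).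
  by apply: ler_sum => a _; apply: ler_sum => b _; exact: cos_le1.
by rewrite sumr_const card_ord sumr_const card_ord -mulrnA mulnn natrX.
Qed.

(* Multiplying by [2 sin (pi x)] makes both sums in [fejerE] telescope. *)
Lemma fejer_sin2 K x : fejer K x * sin (pi * x) ^+ 2 <= 2.
Proof.
set c := \sum_(a < K) cos (2 * pi * a%:R * x).
set s := \sum_(a < K) sin (2 * pi * a%:R * x).
have hc : 2 * sin (pi * x) * c = sin (2 * pi * K%:R * x - pi * x) + sin (pi * x).
  rewrite /c; elim: K {c s} => [|K IH].
    by rewrite big_ord0 mulr0 mulr0 mul0r sub0r sinN addNr.
  rewrite big_ord_recr/= mulrDr IH.
  have -> : 2 * pi * K.+1%:R * x - pi * x = 2 * pi * K%:R * x + pi * x.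
    by rewrite -[K.+1]addn1 natrD; ring.
  by rewrite sinB sinD; ring.
have hs : 2 * sin (pi * x) * s = cos (pi * x) - cos (2 * pi * K%:R * x - pi * x).
  rewrite /s; elim: K {c s hc} => [|K IH].
    by rewrite big_ord0 mulr0 mulr0 mul0r sub0r cosN subrr.
  rewrite big_ord_recr/= mulrDr IH.
  have -> : 2 * pi * K.+1%:R * x - pi * x = 2 * pi * K%:R * x + pi * x.
    by rewrite -[K.+1]addn1 natrD; ring.
  by rewrite cosB cosD; ring.
have sq u w : `|u| <= 1 -> `|w| <= 1 -> (u + w) ^+ 2 <= 4 :> R.
  move=> hu hw; rewrite -real_normK ?num_real//.
  apply: le_trans (_ : (2:R) ^+ 2 <= 4); last by rewrite expr2 -natrM.
  by rewrite ler_sqr ?nnegrE// (le_trans (ler_normD _ _))//; lra.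
have h1 : (2 * sin (pi * x) * c) ^+ 2 <= 4 by rewrite hc; apply: sq; exact: sin_max.
have h2 : (2 * sin (pi * x) * s) ^+ 2 <= 4.
  by rewrite hs; apply: sq; rewrite ?normrN; exact: cos_max.
have -> : fejer K x = c ^+ 2 + s ^+ 2 by exact: fejerE.
move: h1 h2; rewrite !exprMn; set p := sin _ ^+ 2; set q := c ^+ 2; set r := s ^+ 2.
lra.
Qed.

End FejerKernel.

(** * Mass of small balls under a rotation-invariant probability *)

Section InvariantProbability.
Variables (R : realType) (D : nat) (v : torus R D).
Variable m : probability (torus R D) R.
Hypothesis inv_m :
  forall A, measurable A -> m ((fun t => t + v) @^-1` A) = m A.
Implicit Types (t u : torus R D) (n : 'rV[int]_D).

Lemma inv_prob_iter A k : measurable A ->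
  m ((fun t => t + v *+ k) @^-1` A) = m A.
Proof.
move=> mA; elim: k => [|k IH].
  by congr (m _); apply/funext => t /=; rewrite mulr0n addr0.
rewrite -{}IH -[RHS]inv_m.
  by congr (m _); apply/funext => t /=; rewrite mulrS addrA.
by rewrite -[X in measurable X]setTI; exact: measurable_torus_addr.
Qed.

Lemma measurable_g_lt r : measurable [set t : torus R D | g t < r].
Proof.
rewrite (_ : [set _ | _] = @g R D @^-1` `]-oo, r[%classic).
  by rewrite -[X in measurable X]setTI; apply: measurable_g => //; exact: measurable_itv.
by apply/seteqP; split=> t /=; rewrite in_itv.
Qed.

(* Translates of a small ball by the first multiples of [v] are disjoint. *)
Lemma prob_g_lt_le (c d M : R) : 0 < c -> 1 < d ->
  (forall k : nat, (1 <= k)%N -> c * k%:R `^ (- d) <= g (v *+ k)) ->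
  (m [set t | (g t < expR (- M))%R] <= (2 * (c / 2) `^ (- d^-1) * expR (- d^-1 * M))%:E)%E.
Proof.
move=> c0 d1 hv.
have d0 : 0 < d by rewrite (lt_trans _ d1).
set S := [set t | _].
have mS : measurable S by exact: measurable_g_lt.
(* [X] solves [c X^-d = 2 exp (- M)]: no two points of the ball are joined by a time up to [X]. The
   [K = floor X] disjoint translates give [K m(S) <= 1]; one more [m(S) <= 1] passes from [K] to [X]
   and causes the factor [2]. *)
pose X := (c / 2) `^ d^-1 * expR (d^-1 * M).
have X0 : 0 < X by rewrite mulr_gt0 ?expR_gt0// powR_gt0// divr_gt0.
have -> : 2 * (c / 2) `^ (- d^-1) * expR (- d^-1 * M) = 2 / X.
  by rewrite /X powRN mulNr expRN invfM mulrA.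
pose K := Num.trunc X.
have /andP[KX XK] : K%:R <= X < K.+1%:R by exact: truncn_itv (ltW X0).
have mle1 : fine (m S) <= 1.
  by rewrite -lee_fin -fine_prob//; exact: probability_le1.
rewrite fine_prob// lee_fin ler_pdivlMr//.
suff hK : K%:R * fine (m S) <= 1.
  have m0 : 0 <= fine (m S) by exact: fine_ge0.
  have : K.+1%:R * fine (m S) <= 2 by rewrite -[K.+1]addn1 natrD mulrDl mul1r; lra.
  apply: le_trans; rewrite mulrC ler_wpM2r// ltW//.
pose A k : set (torus R D) :=
  if (k < K)%N then (fun t => t + v *+ k) @^-1` S else set0.
have mA k : measurable (A k).
  rewrite /A; case: ifP => // _.
  by rewrite -[X in measurable X]setTI; exact: measurable_torus_addr.
have tA : trivIset setT A.
  have disj k k' t : (k < k')%N -> A k t -> A k' t -> False.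
    move=> kk'; rewrite /A; case: ifP => // kK; case: ifP => // k'K /= h h'.
    have m0 : (0 < k' - k)%N by rewrite subn_gt0.
    have hsub : g (v *+ (k' - k)) < 2 * expR (- M).
      rewrite (_ : v *+ (k' - k) = (t + v *+ k') - (t + v *+ k)).
        by apply: le_lt_trans (gB _ _) _; move: h h'; rewrite /S/=; lra.
      by rewrite mulrnBr 1?ltnW// opprD addrACA subrr add0r.
    have := le_lt_trans (hv _ m0) hsub; apply/negP; rewrite -leNgt.
    have mK : (k' - k)%:R <= X.
      by apply: le_trans KX; rewrite ler_nat (leq_trans (leq_subr _ _))// ltnW.
    have m0R : 0 < (k' - k)%:R :> R by rewrite ltr0n.
    rewrite powRN ler_pdivlMr ?powR_gt0//.
    have : (k' - k)%:R `^ d <= X `^ d.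
      by apply: ge0_ler_powR; rewrite ?nnegrE ?(ltW d0) ?(ltW X0) ?(ltW m0R).
    have -> : X `^ d = c / 2 * expR M.
      rewrite /X powRM ?powR_ge0 ?expR_ge0// -powRrM mulVf ?gt_eqF// powRr1.
        by rewrite -expRM [_ * M * d]mulrAC mulVf ?gt_eqF// mul1r.
      by rewrite divr_ge0// ltW.
    move=> h2; have e0 := expR_gt0 (- M).
    apply: le_trans (ler_wpM2l _ h2) _; first by rewrite mulr_ge0 ?ltW.
    rewrite mulrACA [_ * expR M]mulrC -expRD subrr expR0 mulr1.
    by rewrite mulrCA divff ?mulr1.
  apply/trivIsetP => k k' _ _ kk'; apply/seteqP; split=> // t [hk hk'] /=.
  by move: kk'; rewrite neq_ltn => /orP[/disj h|/disj h]; apply: h; eassumption.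
have : (m (\big[setU/set0]_(k < K) A k) <= 1)%E.
  by apply: probability_le1; apply: bigsetU_measurable => k _.
rewrite measure_bigsetU// (eq_bigr (fun=> (fine (m S))%:E)) => [|k _]; last first.
  rewrite /A ltn_ord; transitivity (m S); last exact: fine_prob.
  exact: inv_prob_iter.
by rewrite sumEFin lee_fin sumr_const card_ord mulr_natl.
Qed.

Definition char_phase n t : R := \sum_i torus_coord t i * (n ord0 i)%:~R.

Lemma char_phase_proj n (a : 'rV[R]_D) : exists z : int,
  char_phase n (torus_proj a) = \sum_i a ord0 i * (n ord0 i)%:~R + z%:~R.
Proof.
have : char_phase n (torus_proj a) - \sum_i a ord0 i * (n ord0 i)%:~R \is a Num.int.
  rewrite /char_phase -sumrB; apply: rpred_sum => i _; rewrite -mulrBl.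
  have [z ->] := torus_coord_proj a i.
  by rewrite addrAC subrr add0r -intrM intr_int.
by move=> /intrP[z hz]; exists z; rewrite -hz addrC subrK.
Qed.

(** With [char_sin], the real and imaginary parts of the character [e^(2 pi i <t, n>)]. The phase is
    additive in [t] only modulo integers, which these functions do not see. *)
Definition char_cos n t : R := cos (2 * pi * char_phase n t).
Definition char_sin n t : R := sin (2 * pi * char_phase n t).

Lemma char_cos_proj n (a : 'rV[R]_D) :
  char_cos n (torus_proj a) = cos (2 * pi * \sum_i a ord0 i * (n ord0 i)%:~R).
Proof. by rewrite /char_cos; have [z ->] := char_phase_proj n a; rewrite cos_2pi_addz. Qed.

Lemma char_sin_proj n (a : 'rV[R]_D) :
  char_sin n (torus_proj a) = sin (2 * pi * \sum_i a ord0 i * (n ord0 i)%:~R).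
Proof. by rewrite /char_sin; have [z ->] := char_phase_proj n a; rewrite sin_2pi_addz. Qed.

Lemma char_sumD n (a b : 'rV[R]_D) : \sum_i (a + b) ord0 i * (n ord0 i)%:~R =
  \sum_i a ord0 i * (n ord0 i)%:~R + \sum_i b ord0 i * (n ord0 i)%:~R.
Proof. by rewrite -big_split/=; apply: eq_bigr => i _; rewrite mxE mulrDl. Qed.

Lemma char_cosD n t u : char_cos n (t + u) =
  char_cos n t * char_cos n u - char_sin n t * char_sin n u.
Proof.
have [a ->] := torus_proj_surj t; have [b ->] := torus_proj_surj u.
by rewrite -torus_projD !char_cos_proj !char_sin_proj char_sumD mulrDr cosD.
Qed.

Lemma char_sinD n t u : char_sin n (t + u) =
  char_sin n t * char_cos n u + char_cos n t * char_sin n u.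
Proof.
have [a ->] := torus_proj_surj t; have [b ->] := torus_proj_surj u.
by rewrite -torus_projD !char_cos_proj !char_sin_proj char_sumD mulrDr sinD.
Qed.

Lemma continuous_char_sum n :
  continuous (fun a : 'rV[R]_D => 2 * pi * \sum_i a ord0 i * (n ord0 i)%:~R).
Proof.
apply: continuous_cmul; apply: continuous_sum => i.
rewrite (_ : (fun a => _) = (fun a : 'rV[R]_D => (n ord0 i)%:~R * a ord0 i)).
  by apply: continuous_cmul; exact: continuous_entry.
by apply/funext => a; rewrite mulrC.
Qed.

Lemma bounded_mfun_char_cos n : bounded_mfun (char_cos n).
Proof.
split; last by exists 1 => t; exact: cos_max.
apply: measurable_torus_fun; rewrite (_ : _ \o _ = fun a : 'rV[R]_D =>
    cos (2 * pi * \sum_i a ord0 i * (n ord0 i)%:~R)).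
  by apply: (continuous_compose _ (@continuous_cos R)); exact: continuous_char_sum.
by apply/funext => a /=; rewrite char_cos_proj.
Qed.

Lemma bounded_mfun_char_sin n : bounded_mfun (char_sin n).
Proof.
split; last by exists 1 => t; exact: sin_max.
apply: measurable_torus_fun; rewrite (_ : _ \o _ = fun a : 'rV[R]_D =>
    sin (2 * pi * \sum_i a ord0 i * (n ord0 i)%:~R)).
  by apply: (continuous_compose _ (@continuous_sin R)); exact: continuous_char_sum.
by apply/funext => a /=; rewrite char_sin_proj.
Qed.

Hypothesis irr_v : totally_irrational v.

(* Invariance makes the vector of the two integrals a fixed point of the
   rotation by the angle of the character at [v], which is nontrivial. *)
Lemma integral_char_cos n : n != 0 -> \int[m]_t char_cos n t = 0.
Proof.
move=> n0.
set c := \int[m]_t char_cos n t; set s := \int[m]_t char_sin n t.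
have bc := bounded_mfun_char_cos n; have bs := bounded_mfun_char_sin n.
have scal (r : R) f : bounded_mfun f -> bounded_mfun (fun t => r * f t).
  by move=> bf; apply: bounded_mfunM => //; exact: bounded_mfun_cst.
have int_scal (r : R) f : bounded_mfun f -> \int[m]_t (r * f t) = r * \int[m]_t f t.
  by move=> bf; rewrite RintegralZl//; exact: bounded_mfun_integrable.
have hc : c = char_cos n v * c + (- char_sin n v) * s.
  rewrite {1}/c -(@Rintegral_preserved _ _ _ m (fun t => t + v))//; last exact: measurable_torus_addr.
  rewrite /c /s -!int_scal// -RintegralD//; try (apply: bounded_mfun_integrable; exact: scal).
  by apply: eq_Rintegral => t _; rewrite char_cosD; ring.
have hs : s = char_cos n v * s + char_sin n v * c.
  rewrite {1}/s -(@Rintegral_preserved _ _ _ m (fun t => t + v))//; last exact: measurable_torus_addr.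
  rewrite /c /s -!int_scal// -RintegralD//; try (apply: bounded_mfun_integrable; exact: scal).
  by apply: eq_Rintegral => t _; rewrite char_sinD; ring.
have h1 : char_cos n v != 1.
  apply/eqP => /cos_2pi_eq1 /irr_v n0'; by rewrite n0' eqxx in n0.
have := cos2Dsin2 (2 * pi * char_phase n v); rewrite -/(char_cos n v) -/(char_sin n v).
move: h1 hc hs; set p := char_cos n v; set q := char_sin n v => h1 hc hs hpq.
(* Eliminating [s] gives [((1 - p)^2 + q^2) c = 0], and the bracket equals [2 (1 - p)] because
   [p^2 + q^2 = 1]. *)
have : (1 - p) * c = 0.
  have e1 : (1 - p) * c = - q * s by rewrite mulrBl mul1r {1}hc; ring.
  have e2 : (1 - p) * s = q * c by rewrite mulrBl mul1r {1}hs; ring.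
  have e3 : (1 - p) * c * 2 = 0.
    have : (1 - p) * ((1 - p) * c) = - q * ((1 - p) * s) by rewrite e1; ring.
    rewrite e2 => e4.
    have : ((1 - p) * c) * 2 = (1 - p) * ((1 - p) * c) + q * (q * c) + (1 - (p ^+ 2 + q ^+ 2)) * c.
      by ring.
    by rewrite e4 hpq => ->; ring.
  by move/eqP: e3; rewrite mulf_eq0 pnatr_eq0/= orbF => /eqP.
by move/eqP; rewrite mulf_eq0 subr_eq0 eq_sym (negPf h1)/= => /eqP.
Qed.

Lemma integral_char_cos0 : \int[m]_t char_cos 0 t = 1.
Proof.
rewrite (@eq_Rintegral _ _ _ m setT (cst 1)).
  rewrite Rintegral_cst// [X in fine X](_ : _ = 1%E) ?mulr1//.
  exact: probability_setT.
move=> t _; rewrite /char_cos /char_phase big1 ?mulr0 ?cos0// => i _.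
by rewrite mxE mulr0.
Qed.

Lemma char_phaseD n n' t : char_phase (n + n') t = char_phase n t + char_phase n' t.
Proof. by rewrite -big_split/=; apply: eq_bigr => i _; rewrite mxE intrD mulrDr. Qed.

Lemma char_phase_delta (z : int) i t :
  char_phase (z *: delta_mx ord0 i) t = torus_coord t i * z%:~R.
Proof.
rewrite /char_phase (bigD1 i)//= big1 => [|j ji]; rewrite !mxE.
  by rewrite !eqxx mulr1 addr0.
by rewrite eqxx (negPf ji) mulr0 mulr0.
Qed.

Definition fejer_prod K (s : seq 'I_D) t : R :=
  \prod_(i <- s) fejer K (torus_coord t i).

Lemma fejer_char K i n t : fejer K (torus_coord t i) * char_cos n t =
  \sum_(a < K) \sum_(b < K) 2^-1 *
    (char_cos (n + (a%:Z - b%:Z) *: delta_mx ord0 i) t +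
     char_cos (n - (a%:Z - b%:Z) *: delta_mx ord0 i) t).
Proof.
rewrite /fejer mulr_suml; apply: eq_bigr => a _; rewrite mulr_suml; apply: eq_bigr => b _.
have hz : (a%:Z - b%:Z)%:~R = a%:R - b%:R :> R by rewrite rmorphB.
rewrite /char_cos !char_phaseD -scaleNr !char_phase_delta rmorphN/= hz mulrN.
have -> : 2 * pi * (a%:R - b%:R) * torus_coord t i =
  2 * pi * (torus_coord t i * (a%:R - b%:R)) by ring.
set th := char_phase n t; set y := torus_coord t i * _.
by rewrite (mulrBr _ th) (mulrDr _ th) cosD cosB; field.
Qed.

Lemma bounded_mfun_fejer K i : bounded_mfun (fun t => fejer K (torus_coord t i)).
Proof.
rewrite (_ : (fun t => _) = (fun t => \sum_(a < K) \sum_(b < K)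
    char_cos ((a%:Z - b%:Z) *: delta_mx ord0 i) t)); last first.
  apply/funext => t; apply: eq_bigr => a _; apply: eq_bigr => b _.
  by rewrite /char_cos char_phase_delta rmorphB/=; congr cos; ring.
apply: bounded_mfun_sum => a; apply: bounded_mfun_sum => b.
exact: bounded_mfun_char_cos.
Qed.

Lemma bounded_mfun_fejer_prod K s : bounded_mfun (fejer_prod K s).
Proof. by apply: bounded_mfun_prod => i; exact: bounded_mfun_fejer. Qed.

(** Expanding the factor of a coordinate [i] shifts the frequency by multiples [a - b] of the unit
    vector [i]. Since [n] vanishes at [i], a shifted frequency is zero only if [n = 0] and [a = b];
    the [K] diagonal terms give one factor [K]. The entries of [n] in the rest of [s] stay zero, so
    the induction, over all such [n], goes on; non-zero frequencies integrate to [0]. *)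
Lemma integral_fejer_char K s n : uniq s -> (forall i, i \in s -> n ord0 i = 0) ->
  \int[m]_t (fejer_prod K s t * char_cos n t) = K%:R ^+ size s * (n == 0)%:R.
Proof.
elim: s n => [|i s IH] n.
  move=> _ _; rewrite expr0 mul1r (@eq_Rintegral _ _ _ m setT (char_cos n)) => [|t _]; last first.
    by rewrite /fejer_prod big_nil mul1r.
  have [->|n0] := eqVneq n 0; first by rewrite integral_char_cos0.
  by rewrite integral_char_cos.
move=> /= /andP[is' us] hn.
pose e a b : 'rV[int]_D := (a%:Z - b%:Z) *: delta_mx ord0 i.
have bm n' : bounded_mfun (fun t => fejer_prod K s t * char_cos n' t).
  by apply: bounded_mfunM; [exact: bounded_mfun_fejer_prod|exact: bounded_mfun_char_cos].
rewrite (@eq_Rintegral _ _ _ m setT (fun t => \sum_(a < K) \sum_(b < K) 2^-1 *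
    (fejer_prod K s t * char_cos (n + e a b) t +
     fejer_prod K s t * char_cos (n - e a b) t))); last first.
  move=> t _; rewrite /fejer_prod big_cons mulrAC fejer_char mulr_suml.
  apply: eq_bigr => a _; rewrite mulr_suml; apply: eq_bigr => b _.
  by rewrite /e; ring.
have bm2 a b : bounded_mfun (fun t => 2^-1 *
    (fejer_prod K s t * char_cos (n + e a b) t +
     fejer_prod K s t * char_cos (n - e a b) t)).
  by apply: bounded_mfunM; [exact: bounded_mfun_cst|exact: bounded_mfunD].
have en a b j : j \in s -> (n + e a b) ord0 j = 0 /\ (n - e a b) ord0 j = 0.
  move=> js; rewrite !mxE hn ?inE ?js ?orbT// eqxx/=.
  have -> : (j == i) = false by apply: contraNF is' => /eqP <-.
  by rewrite mulr0 oppr0 addr0.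
have ni : n ord0 i = 0 by apply: hn; rewrite inE eqxx.
have eab (a b : nat) (sg : bool) : (n + (-1) ^+ sg *: e a b == 0) = (n == 0) && (a == b).
  apply/idP/andP => [/eqP h|[/eqP -> /eqP ->]]; last first.
    by rewrite /e subrr scale0r scaler0 addr0.
  have := congr1 (fun A : 'rV[int]_D => A ord0 i) h; rewrite !mxE ni add0r !eqxx/= mulr1.
  move=> /eqP; rewrite mulf_eq0 signr_eq0/= subr_eq0 eqz_nat => /eqP ab.
  by move: h; rewrite /e ab subrr scale0r scaler0 addr0 => ->.
rewrite integral_prob_sum; last by move=> a; exact: bounded_mfun_sum.
under eq_bigr => a _.
  rewrite integral_prob_sum//.
  under eq_bigr => b _.
    rewrite RintegralZl//; last by apply: bounded_mfun_integrable; exact: bounded_mfunD.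
    rewrite RintegralD//; try exact: bounded_mfun_integrable.
    rewrite !IH//; try by move=> j /(en a b)[].
    have -> : (n + e a b == 0) = (n == 0) && (a == b).
      by have := eab a b false; rewrite expr0 scale1r.
    have -> : (n - e a b == 0) = (n == 0) && (a == b).
      by have := eab a b true; rewrite expr1 scaleN1r.
    over.
  over.
under eq_bigr => a _.
  rewrite (bigD1 a)//= big1 => [|b ba]; last first.
    by rewrite (eq_sym a b) (negPf ba) andbF mulr0 addr0 mulr0.
  over.
rewrite (eq_bigr (fun=> K%:R ^+ size s * (n == 0)%:R)) => [|a _].
  by rewrite sumr_const card_ord exprS -[LHS]mulr_natl mulrA.
by rewrite eqxx andbT addr0; field.
Qed.

Lemma integral_fejer_prod K s : uniq s -> \int[m]_t fejer_prod K s t = K%:R ^+ size s.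
Proof.
move=> us; rewrite (@eq_Rintegral _ _ _ m setT (fun t => fejer_prod K s t * char_cos 0 t)).
  by rewrite integral_fejer_char// ?eqxx ?mulr1// => i _; rewrite mxE.
move=> t _; rewrite /char_cos /char_phase big1 ?mulr0 ?cos0 ?mulr1// => i _.
by rewrite mxE mulr0.
Qed.

(* The kernel has total mass [K ^ D], mass at most [2 K ^ (D - 1) / r ^ 2] where
   [|sin (pi t_i)| >= r], and values at most [K ^ (2 D)]. *)
Lemma prob_g_lt_ge r : (0 < D)%N -> 0 < r <= 1 ->
  ((2^-1 * (r ^+ 2 / (5 * D%:R)) ^+ D)%:E <= m [set t | (g t < r)%R])%E.
Proof.
move=> D0 /andP[r0 r1].
set S := [set t | _]; have mS : measurable S by exact: measurable_g_lt.
have r20 : 0 < r ^+ 2 by rewrite exprn_gt0.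
have D0R : 0 < D%:R :> R by rewrite ltr0n.
have X0 : 0 < 4 * D%:R / r ^+ 2 by rewrite divr_gt0// mulr_gt0.
(* [K > 4 D / r^2] makes the total mass [2 D K^(D-1) / r^2] of the error terms at most half of
   [K^D]; [r <= 1 <= D] keeps [K] below [5 D / r^2]. *)
pose K := (Num.trunc (4 * D%:R / r ^+ 2)).+1.
have /andP[KX XK] := truncn_itv (ltW X0); rewrite -/K in XK.
have K0 : 0 < K%:R :> R by rewrite ltr0n.
have Kle : K%:R <= 5 * D%:R / r ^+ 2.
  rewrite /K -addn1 natrD; apply: le_trans (lerD KX (lexx 1)) _.
  rewrite -lerBrDl -mulrBl; rewrite ler_pdivlMr//.
  have : r ^+ 2 <= 1 by rewrite expr_le1// ltW.
  have : 1 <= D%:R :> R by rewrite ler1n.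
  lra.
pose s := enum 'I_D.
have us : uniq s by exact: enum_uniq.
have ss : size s = D by rewrite size_enum_ord.
have pw t : fejer_prod K s t <= K%:R ^+ (2 * D) * \1_S t +
    \sum_(i <- s) 2 / r ^+ 2 * fejer_prod K (rem i s) t.
  have fp0 s' : 0 <= fejer_prod K s' t by apply: prodr_ge0 => i _; exact: fejer_ge0.
  have sum0 : 0 <= \sum_(i <- s) 2 / r ^+ 2 * fejer_prod K (rem i s) t.
    by apply: sumr_ge0 => i _; rewrite mulr_ge0// divr_ge0// ltW.
  rewrite indicE; case: (boolP (t \in S)) => [_|].
    rewrite mulr1; apply: (@le_trans _ _ (K%:R ^+ (2 * D))); last by rewrite lerDl.
    rewrite exprM -[in leRHS]ss; elim: (s) => [|i s' IH].
      by rewrite /fejer_prod big_nil.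
    by rewrite /fejer_prod big_cons/= exprS ler_pM// ?fejer_ge0 ?fejer_le ?fp0.
  rewrite notin_setE /S/= => /negP; rewrite -leNgt => rg.
  rewrite mulr0 add0r.
  (* [g t] is the mean of the [D] sines, so one of them is at least [r]. The index depends on [t],
     hence the sum over all [i] in the majorant. *)
  have [i hi] : exists i, r <= `|sin (pi * torus_coord t i)|.
    apply/not_existsP => h; move: rg; apply/negP; rewrite -ltNge gE mulrC ltr_pdivrMr//.
    apply: (@lt_le_trans _ _ (\sum_(i < D) r)); last first.
      by rewrite sumr_const card_ord mulr_natr.
    apply: (@ltr_sum _ _ _ xpredT).
      by apply/hasP; exists (Ordinal D0); rewrite ?mem_index_enum.
    by move=> i _; rewrite ltNge; apply/negP => hi; exact: (h i hi).
  have is_ : i \in s by rewrite mem_enum.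
  rewrite (big_rem i)//=; apply: (@le_trans _ _ (2 / r ^+ 2 * fejer_prod K (rem i s) t)); last first.
    by rewrite lerDl; apply: sumr_ge0 => j _; rewrite mulr_ge0// divr_ge0// ltW.
  rewrite {1}/fejer_prod (big_rem i)//=; apply: ler_wpM2r; first exact: fp0.
  rewrite ler_pdivlMr//.
  apply: le_trans (fejer_sin2 K (torus_coord t i)); rewrite ler_wpM2l ?fejer_ge0//.
  by rewrite -[leRHS]real_normK ?num_real// ler_sqr ?nnegrE// ltW.
have bI : bounded_mfun (fun t => K%:R ^+ (2 * D) * \1_S t : R).
  by apply: (@bounded_mfunM _ _ _ (cst _) \1_S); [exact: bounded_mfun_cst|exact: bounded_mfun_indic].
have bF i : bounded_mfun (fun t => 2 / r ^+ 2 * fejer_prod K (rem i s) t).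
  by apply: (@bounded_mfunM _ _ _ (cst _)); [exact: bounded_mfun_cst|exact: bounded_mfun_fejer_prod].
have : \int[m]_t fejer_prod K s t <= \int[m]_t (K%:R ^+ (2 * D) * \1_S t +
    \sum_(i <- s) 2 / r ^+ 2 * fejer_prod K (rem i s) t).
  apply: le_Rintegral => //; apply: bounded_mfun_integrable.
    exact: bounded_mfun_fejer_prod.
  by apply: bounded_mfunD => //; exact: bounded_mfun_sum.
rewrite RintegralD//; try apply: bounded_mfun_integrable => //; last exact: bounded_mfun_sum.
rewrite integral_fejer_prod// ss RintegralZl//; last by apply: bounded_mfun_integrable; exact: bounded_mfun_indic.
rewrite Rintegral_indicT// integral_prob_sum//.
rewrite (eq_big_seq (fun=> 2 / r ^+ 2 * K%:R ^+ D.-1)); last first.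
  move=> i is_ /=; rewrite RintegralZl//; last by apply: bounded_mfun_integrable; exact: bounded_mfun_fejer_prod.
  by rewrite integral_fejer_prod ?rem_uniq// size_rem// ss.
rewrite big_const_seq count_predT ss iter_addr_0 => h.
have hKD : K%:R ^+ D = K%:R * K%:R ^+ D.-1 :> R by rewrite -exprS prednK.
have h2 : 2 / r ^+ 2 * K%:R ^+ D.-1 *+ D <= 2^-1 * K%:R ^+ D.
  rewrite hKD -mulr_natr mulrAC mulrA; apply: ler_wpM2r; first exact: exprn_ge0.
  have e : 4 * D%:R / r ^+ 2 = 2 / r ^+ 2 * D%:R * 2 by ring.
  by move: XK; rewrite e; lra.
have KD0 : 0 < K%:R ^+ D :> R by rewrite exprn_gt0.
have h3 : 2^-1 * K%:R ^+ D <= K%:R ^+ (2 * D) * fine (m S) by move: h h2; lra.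
rewrite fine_prob// lee_fin.
have h4 : 2^-1 <= K%:R ^+ D * fine (m S).
  by rewrite -(ler_pM2r KD0); move: h3; rewrite mul2n -addnn exprD; lra.
have m0 : 0 <= fine (m S) by exact: fine_ge0.
have h5 : K%:R ^+ D <= (5 * D%:R / r ^+ 2) ^+ D by rewrite lerXn2r// ?nnegrE ?(le_trans _ Kle) // ltW.
have h6 : 0 < (5 * D%:R / r ^+ 2) ^+ D by exact: lt_le_trans KD0 h5.
rewrite -[r ^+ 2 / _]invrK invf_div exprVn ler_pdivrMr//.
by rewrite mulrC (le_trans h4)// ler_wpM2r.
Qed.

End InvariantProbability.

(** * The fibre maps *)

Section Tanh.
Variable R : realType.
Implicit Types x y : R.

Definition sech2 x : R := 4 / (expR x + expR (- x)) ^+ 2.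

Lemma expRD_expRN_gt0 x : 0 < expR x + expR (- x).
Proof. by rewrite addr_gt0 ?expR_gt0. Qed.

Lemma expRD_expRN_ge2 x : 2 <= expR x + expR (- x).
Proof. by have := expR_ge1Dx x; have := expR_ge1Dx (- x); lra. Qed.

Lemma expRMexpRN x : expR x * expR (- x) = 1.
Proof. by rewrite -expRD subrr expR0. Qed.

Lemma sech2_gt0 x : 0 < sech2 x.
Proof. by rewrite divr_gt0// exprn_gt0// expRD_expRN_gt0. Qed.

Lemma sech2_le1 x : sech2 x <= 1.
Proof.
rewrite ler_pdivrMr ?exprn_gt0 ?expRD_expRN_gt0// mul1r.
by have := expRD_expRN_ge2 x; set s := _ + _; nra.
Qed.

Lemma is_derive_expRN x : is_derive x 1 (fun y => expR (- y)) (- expR (- x)).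
Proof.
have h := is_derive1_comp (is_derive_expR (- x)) (is_deriveN (is_derive_id x 1)).
by apply: is_derive_eq h _; rewrite mulrN1.
Qed.

Lemma sech2E x : sech2 x = 1 - tanh x ^+ 2.
Proof.
rewrite /sech2 /tanh; have := expRMexpRN x; have := expRD_expRN_gt0 x.
set a := expR x; set b := expR (- x) => ab0 ab.
have ab1 : a + b != 0 by rewrite gt_eqF.
have -> : 4 / (a + b) ^+ 2 = 4 * (a * b) / (a + b) ^+ 2 by rewrite ab mulr1.
by field.
Qed.

Lemma is_derive_tanh x : is_derive x 1 (@tanh R) (sech2 x).
Proof.
have hN := is_derive_expRN x; have hE := is_derive_expR x.
have hV := @is_deriveV R (fun y => expR y + expR (- y)) x _ 1
  (lt0r_neq0 (expRD_expRN_gt0 x)) (is_deriveD hE hN).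
have h := is_deriveM (is_deriveB hE hN) hV.
apply: is_derive_eq h _; rewrite /sech2 /=.
have ab := expRMexpRN x; have ab0 := lt0r_neq0 (expRD_expRN_gt0 x).
set a := expR x in ab ab0 *; set b := expR (- x) in ab ab0 *.
rewrite /GRing.scale/= ?fctE -/a -/b.
have -> : 4 / (a + b) ^+ 2 = 4 * (a * b) / (a + b) ^+ 2 by rewrite ab mulr1.
by field.
Qed.

Lemma continuous_tanh : continuous (@tanh R).
Proof.
move=> x; apply: differentiable_continuous; apply/derivable1_diffP.
by have [] := is_derive_tanh x.
Qed.

Lemma tanh0 : tanh (0 : R) = 0.
Proof. by rewrite /tanh oppr0 subrr mul0r. Qed.

Lemma tanh_ge0 x : 0 <= x -> 0 <= tanh x.
Proof.
move=> x0; apply: divr_ge0; last exact: ltW (expRD_expRN_gt0 x).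
by rewrite subr_ge0 ler_expR; lra.
Qed.

Lemma tanh_gt0 x : 0 < x -> 0 < tanh x.
Proof.
move=> x0; apply: divr_gt0; last exact: expRD_expRN_gt0 x.
by rewrite subr_gt0 ltr_expR; lra.
Qed.

Lemma tanh_le1 x : tanh x <= 1.
Proof.
rewrite ler_pdivrMr ?expRD_expRN_gt0// mul1r.
by have := expR_gt0 (- x); lra.
Qed.

Lemma tanh_le x : 0 <= x -> tanh x <= x.
Proof.
move=> x0.
have [c _] := @MVT_segment R (@tanh R) sech2 0 x x0 (fun y _ => is_derive_tanh y)
  (continuous_subspaceT continuous_tanh).
by rewrite tanh0 !subr0 => ->; rewrite ler_piMl// sech2_le1.
Qed.

(** [tanh x] increases with [e^(2x)], and putting [1 + 2 x] in its place gives [x / (1 + x)]. *)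
Lemma tanh_ge x : 0 <= x -> x / (1 + x) <= tanh x.
Proof.
move=> x0; rewrite ler_pdivrMr; last by lra.
rewrite /tanh mulrAC ler_pdivlMr ?expRD_expRN_gt0//.
have h : 1 + 2 * x <= expR x * expR x by have := expR_ge1Dx (x + x); rewrite expRD; lra.
have b0 := expR_gt0 (- x); have ab := expRMexpRN x.
have : (1 + 2 * x) * expR (- x) <= expR x * expR x * expR (- x) by rewrite ler_wpM2r// ltW.
by rewrite -[expR x * expR x * _]mulrA ab mulr1; lra.
Qed.

(** As [x sech^2 x / tanh x = 2 x / sinh (2 x)], the hypothesis says [2 k x <= sinh (2 x)]. It is
    applied with [k = 1] for [x >= 0] and with [k = 3/2] for [x >= 4]. *)
Lemma sech2_tanh_sinh x k : 4 * (k * x) <= expR (x + x) - expR (- (x + x)) ->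
  k * (x * sech2 x) <= tanh x.
Proof.
move=> h; rewrite /sech2 /tanh.
have s0 := expRD_expRN_gt0 x; rewrite ler_pdivlMr//.
have -> : k * (x * (4 / (expR x + expR (- x)) ^+ 2)) * (expR x + expR (- x)) =
   4 * (k * x) / (expR x + expR (- x)).
  by field; rewrite lt0r_neq0.
rewrite ler_pdivrMr//; apply: le_trans h _.
by rewrite opprD !expRD; lra.
Qed.

Lemma sech2_tanh x : 0 <= x -> x * sech2 x <= tanh x.
Proof.
move=> x0; rewrite -[leLHS]mul1r; apply: sech2_tanh_sinh; rewrite mul1r.
pose f (u : R) := expR u - expR (- u).
have df (u : R) : is_derive u 1 f (expR u + expR (- u)).
  by apply: is_derive_eq (is_deriveB (is_derive_expR u) (is_derive_expRN u)) _; rewrite opprK.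
have cf : continuous f.
  move=> u; apply: differentiable_continuous; apply/derivable1_diffP.
  by have [] := df u.
have xx0 : 0 <= x + x by rewrite addr_ge0.
have [c _] := @MVT_segment R f _ 0 (x + x) xx0 (fun y _ => df y) (continuous_subspaceT cf).
rewrite /f oppr0 subrr !subr0 => ->.
have := expRD_expRN_ge2 c; set s := _ + _; nra.
Qed.

Lemma sech2_tanh_ge4 x : 4 <= x -> 3 / 2 * (x * sech2 x) <= tanh x.
Proof.
move=> x4; apply: sech2_tanh_sinh.
have h := expR_ge1Dx x; have h1 : expR (- (x + x)) <= 1 by rewrite expR_le1; lra.
by rewrite expRD; nra.
Qed.

Lemma sech2_ge_half x : 0 <= x <= 2^-1 -> 2^-1 <= sech2 x.
Proof.
case/andP=> x0 x1; rewrite sech2E.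
by have := tanh_le x0; have := tanh_ge0 x0; nra.
Qed.

End Tanh.

(* [x] is a fibre orbit over the sequence [w] of values of [g]. *)
Section FibreOrbit.
Variables (R : realType) (kappa : R) (w x : nat -> R) (n : nat).
Hypothesis kappa_ge1 : 1 <= kappa.
Hypothesis w_le1 : forall k, w k <= 1.
Hypothesis xS : forall k, x k.+1 = tanh (kappa * x k) * w k.

Let kappa_gt0 : 0 < kappa. Proof. exact: lt_le_trans ltr01 kappa_ge1. Qed.

Section Positive.
Hypothesis w_gt0 : forall k, (k < n)%N -> 0 < w k.
Hypothesis x0_itv : 0 < x 0%N <= 1.

Lemma fibre_itv k : (k <= n)%N -> 0 < x k <= 1.
Proof.
elim: k => // k IH kn; have /andP[xk0 xk1] := IH (ltnW kn).
rewrite xS mulr_gt0 ?tanh_gt0 ?mulr_gt0 ?w_gt0//=.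
apply: mulr_ile1; rewrite ?tanh_le1 ?w_le1//; last exact: ltW (w_gt0 kn).
by rewrite tanh_ge0// mulr_ge0// ltW.
Qed.

Let x_gt0 k : (k <= n)%N -> 0 < x k. Proof. by move=> /fibre_itv/andP[]. Qed.

Lemma fibre_step_ge k : (k < n)%N ->
  kappa * x k / (1 + kappa * x k) * w k <= x k.+1.
Proof.
move=> kn; rewrite xS; apply: ler_wpM2r; first exact: ltW (w_gt0 kn).
by apply: tanh_ge; rewrite mulr_ge0 ?(ltW kappa_gt0) ?(ltW (x_gt0 (ltnW kn))).
Qed.

Definition large_fibre k : bool := 4 <= kappa * x k.

(** Both cases come from [tanh_ge] with [y = kappa * x k]: for [y >= 4] the quotient [y / (1 + y)]
    is at least [1/2 >= x k / 2], and for [y < 4] it is at least [y / 5]. Writing the cases with 0-1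
    coefficients lets the inequalities telescope. *)
Lemma fibre_ln_step k : (k < n)%N ->
  ln (x k) + ln (w k) + (1 - (large_fibre k)%:R) * (ln kappa - ln 5)
    - (large_fibre k)%:R * ln 2 <= ln (x k.+1).
Proof.
move=> kn; have xk0 := x_gt0 (ltnW kn); have wk0 := w_gt0 kn.
have /andP[_ xk1] := fibre_itv (ltnW kn).
have step c : 0 < c -> c * x k <= kappa * x k / (1 + kappa * x k) ->
    ln c + ln (x k) + ln (w k) <= ln (x k.+1).
  move=> c0 h; have p1 : 0 < c * x k by rewrite mulr_gt0.
  have p2 : 0 < c * x k * w k by rewrite mulr_gt0.
  have p3 : 0 < x k.+1 by exact: x_gt0.
  rewrite -lnM ?posrE// -lnM ?posrE// ler_ln ?posrE//.
  by apply: le_trans (fibre_step_ge kn); rewrite ler_wpM2r// ltW.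
have kx0 : 0 < kappa * x k by rewrite mulr_gt0.
rewrite /large_fibre; have [h4|h4] := leP 4 (kappa * x k); rewrite /=.
  have := step 2^-1; rewrite lnV ?posrE// => /(_ _ _) st.
  have : - ln 2 + ln (x k) + ln (w k) <= ln (x k.+1).
    apply: st => //; rewrite ler_pdivlMr; last by lra.
    by nra.
  lra.
have := step (kappa / 5); rewrite ln_div ?posrE// => st.
have : ln kappa - ln 5 + ln (x k) + ln (w k) <= ln (x k.+1).
  apply: st; first by rewrite divr_gt0.
  rewrite ler_pdivlMr; last by lra.
  have : kappa * x k * (1 + kappa * x k) <= kappa * x k * 5 by rewrite ler_wpM2l ?(ltW kx0)//; lra.
  lra.
lra.
Qed.

Lemma fibre_ln_sum m : (m <= n)%N ->
  ln (x 0%N) + \sum_(0 <= k < m) ln (w k)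
    + (m%:R - \sum_(0 <= k < m) (large_fibre k)%:R) * (ln kappa - ln 5)
    - (\sum_(0 <= k < m) (large_fibre k)%:R) * ln 2 <= ln (x m).
Proof.
elim: m => [|m IH] mn.
  by rewrite !big_geq//; lra.
have h := fibre_ln_step mn; have h2 := IH (ltnW mn).
apply: le_trans h; rewrite !big_nat_recr//= -[m.+1]addn1 natrD; lra.
Qed.

(** As [x n <= 1], the gains [ln kappa - ln 5] at the small times cannot exceed the losses: [A n]
    from the [w k], [dl n] from the starting point, [n ln 2] from the large times. The assumption on
    [kappa] makes one gain at least twice the loss per step, so at most half of the times are
    small. *)
Lemma large_fibre_count (A dl : R) : 0 <= A -> 0 < dl -> 
  ln 5 + 2 * (A + dl + ln 2) <= ln kappa ->
  \sum_(0 <= k < n) - ln (w k) <= A * n%:R -> expR (- (dl * n%:R)) <= x 0%N ->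
  n%:R / 2 <= \sum_(0 <= k < n) (large_fibre k)%:R :> R.
Proof.
move=> A0 dl0 hk hw hx.
have := fibre_ln_sum (leqnn n).
have : ln (x n) <= 0 by have /andP[? ?] := fibre_itv (leqnn n); exact: ln_le0.
have : - (dl * n%:R) <= ln (x 0%N).
  by rewrite -[leLHS]expRK ler_ln ?posrE ?expR_gt0// x_gt0.
move: hw; rewrite sumrN; set W := \sum_(0 <= k < n) ln _; set I := \sum_(0 <= k < n) _%:R.
have ln2 : 0 < ln 2 :> R by rewrite ln_gt0// ltr1n.
have I1 : I <= n%:R.
  apply: (@le_trans _ _ (\sum_(0 <= k < n) 1)).
    by apply: ler_sum => k _; rewrite lern1 leq_b1.
  by rewrite sumr_const_nat subn0.
have I0 : 0 <= I by apply: sumr_ge0.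
move: (ln (x 0%N)) (ln (x n)) => a b hW ha hb hs.
have hs2 : (n%:R - I) * (ln kappa - ln 5) <= (A + dl + ln 2) * n%:R.
  have : I * ln 2 <= n%:R * ln 2 by rewrite ler_wpM2r// ltW.
  lra.
have q0 : 0 < A + dl + ln 2 by lra.
have : (n%:R - I) * (2 * (A + dl + ln 2)) <= (A + dl + ln 2) * n%:R.
  apply: le_trans hs2; rewrite ler_wpM2l ?subr_ge0//; lra.
rewrite mulrA mulrC ler_pM2l//; lra.
Qed.

Definition fibre_deriv m : R := \prod_(0 <= k < m) (kappa * sech2 (kappa * x k) * w k).

(* [y sech^2 y <= tanh y] compares the derivative with the ratio of consecutive
   fibre coordinates. *)
Lemma fibre_deriv_le m : (m <= n)%N ->
  fibre_deriv m * x 0%N <= x m * expR (- ln (3 / 2) * \sum_(0 <= k < m) (large_fibre k)%:R).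
Proof.
rewrite /fibre_deriv; elim: m => [|m IH] mn.
  by rewrite !big_geq// mulr0 expR0 mul1r mulr1.
have xm0 := x_gt0 (ltnW mn).
have wm0 := w_gt0 mn.
have f0 : 0 <= kappa * sech2 (kappa * x m) * w m.
  by rewrite !mulr_ge0 ?(ltW kappa_gt0) ?(ltW wm0) ?(ltW (sech2_gt0 _)).
rewrite !big_nat_recr//= mulrAC.
apply: le_trans (ler_wpM2r f0 (IH (ltnW mn))) _.
rewrite mulrDr expRD.
set E := expR (_ * \sum_(0 <= k < m) _).
have E0 : 0 <= E by exact: expR_ge0.
suff h : x m * (kappa * sech2 (kappa * x m)) <= tanh (kappa * x m) * expR (- ln (3 / 2) * (large_fibre m)%:R).
  have := ler_wpM2r (mulr_ge0 E0 (ltW wm0)) h; rewrite xS.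
  by set e := expR _; set t := tanh _; set s := sech2 _; lra.
have kx0 : 0 < kappa * x m by rewrite mulr_gt0.
rewrite /large_fibre; have [h4|h4] := leP 4 (kappa * x m); rewrite /=.
  rewrite mulr1 expRN lnK ?posrE//.
  rewrite -ler_pdivrMr ?invr_gt0// invrK.
  have := sech2_tanh_ge4 h4; lra.
rewrite mulr0 expR0 mulr1; have := sech2_tanh (ltW kx0); lra.
Qed.

Lemma fibre_deriv_le1 : n%:R / 2 <= \sum_(0 <= k < n) (large_fibre k)%:R :> R ->
  expR (- (ln (3 / 2) / 2 * n%:R)) <= x 0%N -> fibre_deriv n <= 1.
Proof.
move=> hI hx; have x0 := x_gt0 (leq0n n).
have l0 : 0 < ln (3 / 2) :> R by rewrite ln_gt0//; lra.
rewrite -(ler_pM2r x0) mul1r; apply: le_trans (fibre_deriv_le (leqnn n)) _.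
apply: le_trans hx.
have /andP[xn0 xn1] := fibre_itv (leqnn n).
apply: (@le_trans _ _ (expR (- ln (3 / 2) * \sum_(0 <= k < n) (large_fibre k)%:R))).
  by rewrite ler_piMl ?expR_ge0.
by rewrite ler_expR; nra.
Qed.

(* Unrolling the lower bound for [tanh] back to the last time [k0] at which
   [kappa * x k0 >= 1], or to the initial time. *)
Lemma fibre_ln_ge m : (m <= n)%N -> exists k0 y, [/\ (k0 <= m)%N,
  y = x 0%N /\ k0 = 0%N \/ y = kappa^-1 &
  ln y + \sum_(k0 <= k < m) (ln kappa - ln 2 + ln (w k)) <= ln (x m)].
Proof.
elim: m => [|m IH] mn.
  by exists 0%N, (x 0%N); split=> //; [left|rewrite big_geq// addr0].
have xm0 := x_gt0 (ltnW mn); have kx0 : 0 < kappa * x m by rewrite mulr_gt0.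
have wm0 := w_gt0 mn; have xm1 := x_gt0 mn.
have st := fibre_step_ge mn.
have [h|h] := leP 1 (kappa * x m).
  exists m, kappa^-1; split; [exact: leqW|by right|].
  rewrite big_nat1 lnV ?posrE//.
  suff : - ln 2 + ln (w m) <= ln (x m.+1) by lra.
  rewrite -lnV ?posrE// -lnM ?posrE// ler_ln ?posrE ?mulr_gt0//.
  apply: le_trans st; rewrite ler_wpM2r ?(ltW wm0)// ler_pdivlMr; lra.
have [k0 [y [k0m yP hy]]] := IH (ltnW mn).
exists k0, y; split=> //; first exact: leqW.
rewrite big_nat_recr//= addrA; apply: le_trans (lerD hy (lexx _)) _.
suff : ln (kappa / 2) + ln (x m) + ln (w m) <= ln (x m.+1).
  by rewrite ln_div ?posrE//; lra.
have k20 : 0 < kappa / 2 by rewrite divr_gt0.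
rewrite -!lnM ?posrE ?mulr_gt0// ler_ln ?posrE ?mulr_gt0//.
apply: le_trans st; rewrite ler_wpM2r ?(ltW wm0)// ler_pdivlMr; last by lra.
nra.
Qed.

End Positive.

(* A fibre orbit that starts close enough to [0] follows the linearisation. *)
Lemma fibre_deriv_gt1 : (0 < n)%N -> 0 <= x 0%N -> kappa ^+ n * x 0%N <= 2^-1 ->
  (forall k, 0 <= w k) ->
  (forall k, (k < n)%N -> 0 < w k) ->
  \sum_(0 <= k < n) - ln (w k) < n%:R * (ln kappa - ln 2) ->
  1 < fibre_deriv n.
Proof.
move=> n0 x00 hx w0 wp hw.
have xk k : 0 <= x k <= kappa ^+ k * x 0%N.
  elim: k => [|k /andP[IH0 IH]]; first by rewrite expr0 mul1r x00 lexx.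
  have kx0 : 0 <= kappa * x k by rewrite mulr_ge0// ltW.
  rewrite xS mulr_ge0 ?tanh_ge0//=.
  apply: (@le_trans _ _ (tanh (kappa * x k))); first by rewrite ler_piMr// tanh_ge0.
  by apply: le_trans (tanh_le kx0) _; rewrite exprS -mulrA ler_wpM2l// ltW.
(* Up to time [n] the orbit stays where the slope is at least half the slope [kappa] at zero; this
   accounts for the [- ln 2] in the assumption on the sum. *)
have hs k : (k < n)%N -> 2^-1 <= sech2 (kappa * x k).
  move=> kn; have /andP[h1 h2] := xk k; apply: sech2_ge_half.
  rewrite mulr_ge0 ?(ltW kappa_gt0)//=; apply: le_trans hx.
  apply: (@le_trans _ _ (kappa ^+ k.+1 * x 0%N)).
    by rewrite exprS -mulrA ler_wpM2l// ltW.
  by rewrite ler_wpM2r// ler_weXn2l.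
apply: (@lt_le_trans _ _ (expR (\sum_(0 <= k < n) (ln kappa - ln 2 + ln (w k))))).
  rewrite expR_gt1 big_split/= sumr_const_nat subn0 -[_ *+ n]mulr_natl.
  move: hw; rewrite sumrN; set W := \sum_(0 <= k < n) _; set z := n%:R * _; lra.
rewrite expR_sum /fibre_deriv big_nat_cond [leRHS]big_nat_cond; apply: ler_prod => k /andP[/andP[_ kn] _].
rewrite expR_ge0/= expRD expRB !lnK ?posrE ?wp//; apply: ler_wpM2r; first exact: w0.
by rewrite ler_wpM2l ?(ltW kappa_gt0)// hs.
Qed.

End FibreOrbit.

HB.instance Definition _ d1 d2 (T1 : measurableType d1) (T2 : measurableType d2) :=
  isMeasurableFun.Build _ _ (T1 * T2)%type T1 fst measurable_fst.

(** * The skew product *)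

Section System.
Variables (R : realType) (D : nat) (v : torus R D) (kappa : R).
Implicit Types (p : torus R D * R) (k n N : nat).

Definition orbit_g p k : R := g (p.1 + v *+ k).
Definition orbit_fibre p k : R := (iter k (F v kappa) p).2.

Lemma iterF1 p k : (iter k (F v kappa) p).1 = p.1 + v *+ k.
Proof.
elim: k => [|k IH]; first by rewrite mulr0n addr0.
by rewrite iterS /= IH mulrSr addrA.
Qed.

Lemma orbit_fibreS p k :
  orbit_fibre p k.+1 = tanh (kappa * orbit_fibre p k) * orbit_g p k.
Proof. by rewrite /orbit_fibre iterS /= iterF1. Qed.

Lemma orbit_g_ge0 p k : 0 <= orbit_g p k. Proof. exact: g_ge0. Qed.

Lemma orbit_g_le1 p k : orbit_g p k <= 1. Proof. exact: g_le1. Qed.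

Lemma orbit_g_iter p k n : orbit_g (iter n (F v kappa) p) k = orbit_g p (n + k).
Proof. by rewrite /orbit_g iterF1 -addrA -mulrnDr. Qed.

Lemma measurable_tanh : measurable_fun setT (@tanh R).
Proof. by apply: continuous_measurable_fun; exact: continuous_tanh. Qed.

Lemma measurable_F : measurable_fun setT (F v kappa).
Proof.
apply: measurable_fun_pair.
  by apply: (measurableT_comp (measurable_torus_addr v)); exact: measurable_fst.
apply: measurable_funM.
  apply: (measurableT_comp measurable_tanh).
  by apply: measurable_funM; [exact: measurable_cst|exact: measurable_snd].
by apply: (measurableT_comp (@measurable_g R D)); exact: measurable_fst.
Qed.

Lemma measurable_iterF k : measurable_fun setT (iter k (F v kappa)).
Proof.
elim: k => [|k IH]; first exact: measurable_id.
by apply: (measurableT_comp measurable_F).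
Qed.

Lemma measurable_orbit_fibre k : measurable_fun setT (orbit_fibre ^~ k).
Proof. exact: (measurableT_comp measurable_snd (measurable_iterF k)). Qed.

Lemma measurable_orbit_g k : measurable_fun setT (orbit_g ^~ k).
Proof.
apply: (measurableT_comp (@measurable_g R D)).
apply: (measurableT_comp (measurable_torus_addr (v *+ k))).
exact: measurable_fst.
Qed.

Lemma measurable_phase : measurable (@phase R D).
Proof.
rewrite (_ : @phase R D = snd @^-1` `[0, 1]%classic).
  by rewrite -[X in measurable X]setTI; exact: measurable_snd.
by apply/seteqP; split=> p /=; rewrite in_itv.
Qed.

Definition orbit_deriv p N : R :=
  fibre_deriv kappa (orbit_g p) (orbit_fibre p) N.

Lemma measurable_orbit_deriv N : measurable_fun setT (orbit_deriv ^~ N).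
Proof.
apply: measurable_prod => k _; apply: measurable_funM; last exact: measurable_orbit_g.
apply: measurable_funM; first exact: measurable_cst.
have cs : continuous (@sech2 R).
  rewrite (_ : @sech2 R = fun x => 1 - tanh x ^+ 2); last by apply/funext => x; rewrite sech2E.
  move=> x; apply: cvgB; first exact: cvg_cst.
  by rewrite expr2; apply: cvgM; exact: continuous_tanh.
apply: (measurableT_comp (continuous_measurable_fun cs)).
by apply: measurable_funM; [exact: measurable_cst|exact: measurable_orbit_fibre].
Qed.

Lemma is_derive_orbit_fibre (t : torus R D) (x : R) N :
  is_derive x 1 (fun y => orbit_fibre (t, y) N) (orbit_deriv (t, x) N).
Proof.
elim: N => [|N IH].
  by rewrite /orbit_deriv /fibre_deriv big_geq//; exact: is_derive_id.
pose f (y : R) := kappa * orbit_fibre (t, y) N.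
have hf : is_derive x 1 f (kappa * orbit_deriv (t, x) N).
  by apply: is_derive_eq (is_deriveZ kappa IH) _.
have ht := is_derive1_comp (is_derive_tanh (f x)) hf.
have h := is_deriveZ (orbit_g (t, x) N) ht.
rewrite (_ : (fun y => _) = orbit_g (t, x) N \*: (@tanh R \o f)).
  apply: is_derive_eq h _; rewrite /orbit_deriv /fibre_deriv big_nat_recr//= /f.
  by rewrite /GRing.scale/=; ring.
by apply/funext => y; rewrite orbit_fibreS mulrC.
Qed.

Lemma lyapunov_gt0 p N : (1 <= N)%N ->
  (0 < lyapunov v kappa N p)%E = (1 < orbit_deriv p N).
Proof.
move=> N1; rewrite /lyapunov.
have -> : derive1 (fun x => (iter N (F v kappa) (p.1, x)).2) p.2 = orbit_deriv p N.
  rewrite derive1E; have [_] := is_derive_orbit_fibre p.1 p.2 N.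
  by rewrite -surjective_pairing.
rewrite pmule_rgt0 ?lte_fin ?invr_gt0 ?ltr0n//.
have [d0|d0] := leP (orbit_deriv p N) 0.
  rewrite le0_lneNy ?lee_fin//=; apply/esym/negbTE; rewrite -leNgt.
  by apply: le_trans d0 ler01.
rewrite lne_EFin// lte_fin; apply/idP/idP => [h|h]; last exact: ln_gt0.
by rewrite ltNge; apply: contraL h => h; rewrite -leNgt ln_le0.
Qed.

Lemma expanding_setE N : (1 <= N)%N ->
  [set p | phase p /\ (0 < lyapunov v kappa N p)%E] =
  @phase R D `&` [set p | 1 < orbit_deriv p N].
Proof. by move=> N1; apply/seteqP; split=> p /=; rewrite lyapunov_gt0. Qed.

Lemma measurable_expanding N : (1 <= N)%N ->
  measurable [set p | phase p /\ (0 < lyapunov v kappa N p)%E].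
Proof.
move=> N1; rewrite expanding_setE//; apply: measurableI; first exact: measurable_phase.
rewrite (_ : [set p | _] = (orbit_deriv ^~ N) @^-1` `]1, +oo[%classic).
  by rewrite -[X in measurable X]setTI; exact: measurable_orbit_deriv.
by apply/seteqP; split=> p /=; rewrite in_itv/= andbT.
Qed.

(** * Invariant measures of the skew product *)

Section Invariant.
Hypothesis kappa_ge1 : 1 <= kappa.
Variable P : probability (torus R D * R)%type R.
Hypothesis P_phase : P (@phase R D) = 1%E.
Hypothesis P_inv : invariant_measure v kappa P.

Lemma phaseF p : phase p -> phase (F v kappa p).
Proof.
rewrite /phase/= => /andP[x0 x1].
have kx0 : 0 <= kappa * p.2 by rewrite mulr_ge0// (le_trans ler01).
rewrite mulr_ge0 ?tanh_ge0 ?g_ge0//=.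
by apply: mulr_ile1; rewrite ?tanh_ge0 ?g_ge0 ?tanh_le1 ?g_le1.
Qed.

Lemma prob_phaseI A : measurable A -> P (@phase R D `&` A) = P A.
Proof.
move=> mA; have mp := measurable_phase.
have hC : P (~` @phase R D) = 0%E by rewrite probability_setC// P_phase subee.
rewrite -[in RHS](setIT A) -(setUv (@phase R D)) setIUr measureU.
- rewrite setIC [X in (_ + X)%E](_ : _ = 0%E) ?adde0//.
  apply/eqP; rewrite -measure_le0 -hC; apply: le_measure; rewrite ?inE//.
  + by apply: measurableI => //; exact: measurableC.
  + exact: measurableC.
- exact: measurableI.
- by apply: measurableI => //; exact: measurableC.
- by rewrite setIACA setICr setI0.
Qed.

(** Invariance is given for subsets of [phase]; since [phase] is mapped into itself and has full
    measure, it extends to all measurable sets. *)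
Lemma prob_F A : measurable A -> P (F v kappa @^-1` A) = P A.
Proof.
move=> mA; have mp := measurable_phase.
have mFA B : measurable B -> measurable (F v kappa @^-1` B).
  by move=> mB; rewrite -[X in measurable X]setTI; exact: measurable_F.
rewrite -(prob_phaseI (mFA _ mA)) -(prob_phaseI mA) -(P_inv (measurableI _ _ mp mA)).
  congr (P _); apply/seteqP; split=> p /=.
    by move=> [pp Ap]; split=> //; split=> //; exact: phaseF.
  by move=> [pp [_ Ap]]; split.
by move=> p [].
Qed.

Lemma prob_iterF A k : measurable A -> P (iter k (F v kappa) @^-1` A) = P A.
Proof.
move=> mA; elim: k => [//|k IH].
rewrite -IH -[RHS]prob_F.
  by congr (P _); apply/funext => p /=; rewrite -iterSr.
by rewrite -[X in measurable X]setTI; exact: measurable_iterF.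
Qed.

Definition base_marginal : probability (torus R D) R :=
  distribution P (fst : {mfun (torus R D * R)%type >-> torus R D}).

Lemma base_marginalE A : base_marginal A = P (fst @^-1` A).
Proof. by []. Qed.

Lemma base_marginal_inv A : measurable A ->
  base_marginal ((fun t => t + v) @^-1` A) = base_marginal A.
Proof.
move=> mA; rewrite !base_marginalE -[RHS]prob_F//.
by rewrite -[X in measurable X]setTI; exact: measurable_fst.
Qed.

Lemma measurable_orbit_g_lt k e : measurable [set p | orbit_g p k < e].
Proof.
rewrite (_ : [set p | _] = (orbit_g ^~ k) @^-1` `]-oo, e[%classic).
  by rewrite -[X in measurable X]setTI; exact: measurable_orbit_g.
by apply/seteqP; split=> p /=; rewrite in_itv.
Qed.

Lemma measurable_orbit_fibre_lt k e : measurable [set p | orbit_fibre p k < e].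
Proof.
rewrite (_ : [set p | _] = (orbit_fibre ^~ k) @^-1` `]-oo, e[%classic).
  by rewrite -[X in measurable X]setTI; exact: measurable_orbit_fibre.
by apply/seteqP; split=> p /=; rewrite in_itv.
Qed.

Lemma prob_orbit_g k e :
  P [set p | orbit_g p k < e] = base_marginal [set t | g t < e].
Proof.
rewrite base_marginalE -(@prob_iterF (fst @^-1` [set t | g t < e]) k).
  by congr (P _); apply/seteqP; split=> p /=; rewrite iterF1.
by rewrite -[X in measurable X]setTI; apply: measurable_fst => //; exact: measurable_g_lt.
Qed.

Lemma prob_orbit_fibre k e :
  P [set p | orbit_fibre p k < e] = P [set p | p.2 < e].
Proof.
by rewrite -[RHS](@prob_iterF _ k)//; exact: (measurable_orbit_fibre_lt 0).
Qed.

End Invariant.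
End System.

(** * Haar measure of small balls *)

Section Haar.
Variable R : realType.

Lemma uniform_prob01_le (U : set R) : measurable U ->
  (uniform_prob (@ltr01 R) U <= lebesgue_measure (U `&` `[0%R, 1%R]%classic))%E.
Proof.
move=> mU; rewrite /uniform_prob integral_uniform_pdf.
have mUI : measurable (U `&` `[0%R, 1%R]%classic : set R) by exact: measurableI.
rewrite -[leRHS]mul1e -integral_cst//.
apply: ge0_le_integral => //=.
- by move=> x _; rewrite lee_fin uniform_pdf_ge0.
- by apply/measurable_EFinP/measurable_funTS; exact: measurable_uniform_pdf.
- by move=> x _; rewrite lee_fin /uniform_pdf subr0 invr1; case: ifP.
Qed.

Lemma near_int_of_small_sin (s e : R) : 0 <= s <= 2 ->
  `|sin (pi * s)| < e -> [\/ `|s| < e, `|s - 1| < e | `|s - 2| < e].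
Proof.
case/andP=> s0 s2 h.
have near (z : int) : `|s - z%:~R| <= 2^-1 -> `|s - z%:~R| < e.
  move=> hz; apply: le_lt_trans (norm_le_norm_sin_pi hz) _.
  by rewrite -mulrNz sin_pi_addz.
have [h1|h1] := leP s 2^-1.
  constructor 1; have := near 0; rewrite subr0; apply.
  by rewrite ger0_norm.
have [h2|h2] := leP s (3 / 2).
  by constructor 2; apply: (near 1); rewrite ler_norml; lra.
by constructor 3; apply: (near 2); rewrite ler_norml -[2%:~R]/(2 : R); lra.
Qed.

Lemma measurable_norm_sin_lt (b e : R) :
  measurable [set x : R | `|sin (pi * (x + b))| < e].
Proof.
pose f (x : R) : R := `|sin (pi * (x + b))|.
have mf : measurable_fun setT f.
  apply: continuous_measurable_fun.
  apply: (continuous_compose _ (@norm_continuous _ R)).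
  apply: (continuous_compose _ (@continuous_sin R)).
  apply: continuous_cmul => x.
  by apply: cvgD; [exact: cvg_id|exact: cvg_cst].
rewrite (_ : [set x | _] = f @^-1` `]-oo, e[%classic).
  by rewrite -[X in measurable X]setTI; exact: mf.
by apply/seteqP; split=> x /=; rewrite in_itv.
Qed.

(** [x + b] runs inside [[0, 2]], which contains three zeros of the sine; each contributes an
    interval of length [2 * e]. *)
Lemma uniform_prob01_sin_lt (b e : R) : 0 <= b < 1 -> 0 < e ->
  (uniform_prob (@ltr01 R) [set x | (`|sin (pi * (x + b))| < e)%R] <= (6 * e)%:E)%E.
Proof.
case/andP=> b0 b1 e0; set U := [set x | _].
have mU : measurable U by exact: measurable_norm_sin_lt.
apply: le_trans (uniform_prob01_le mU) _.
pose B (z : R) : set R := ball (z - b) e.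
have mB z : measurable (B z) by exact: measurable_ball.
have sub : U `&` `[0%R, 1%R]%classic `<=` (B 0 `|` B 1) `|` B 2.
  move=> x [Ux /=]; rewrite in_itv/= => /andP[x0 x1].
  have s2 : 0 <= x + b <= 2 by lra.
  have Bz z : `|x + b - z| < e -> B z x.
    by rewrite /B /ball/= distrC opprD addrA addrAC.
  case: (near_int_of_small_sin s2 Ux) => h.
  - by left; left; apply: Bz; rewrite subr0.
  - by left; right; apply: Bz.
  - by right; apply: Bz.
apply: (@le_trans _ _ (lebesgue_measure ((B 0 `|` B 1) `|` B 2))).
  have m12 : measurable (B 0 `|` B 1) by exact: measurableU.
  apply: le_measure; [apply/mem_set|apply/mem_set|exact: sub].
    by apply: measurableI => //; exact: measurable_itv.
  exact: (measurableU _ _ m12 (mB 2)).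
have hB z : lebesgue_measure (B z) = (e *+ 2)%:E by rewrite lebesgue_measure_ball// ltW.
have lB z : (lebesgue_measure (B z) <= (e *+ 2)%:E)%E by rewrite hB.
have h12 := measureU2 (@lebesgue_measure R) (mB 0) (mB 1).
have h123 := measureU2 (@lebesgue_measure R) (measurableU _ _ (mB 0) (mB 1)) (mB 2).
apply: le_trans h123 _.
apply: (le_trans (leeD (le_trans h12 (leeD (lB 0) (lB 1))) (lB 2))).
by rewrite -!EFinD lee_fin mulr2n; lra.
Qed.

Variable D : nat.
Hypothesis D_gt0 : (0 < D)%N.

(** [g < e] forces the first sine below [D * e], so a slab in one uniform coordinate contains the
    set. The order [e] is weaker than the true [e^D], but summable over dyadic [e]. *)
Lemma torus_lebesgue_g_lt (u : torus R D) (e : R) : 0 < e ->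
  (torus_lebesgue R D [set t | (g (t + u) < e)%R] <= (6 * D%:R * e)%:E)%E.
Proof.
move=> e0; case: D D_gt0 u => // n _ u.
pose b : R := torus_coord u ord0.
pose U : set R := [set x | `|sin (pi * (x + b))| < n.+1%:R * e].
have e0' : 0 < n.+1%:R * e by rewrite mulr_gt0// ltr0n.
have hb : 0 <= b < 1 by exact: torus_coord_itv.
have mU : measurable U by exact: measurable_norm_sin_lt.
have mS : measurable [set t : torus R n.+1 | g (t + u) < e].
  rewrite -[X in measurable X]setTI.
  exact: (measurable_torus_addr u measurableT (measurable_g_lt e)).
have mpre : measurable (@torus_of_tuple R n.+1 @^-1` [set t | g (t + u) < e]).
  by rewrite -[X in measurable X]setTI; exact: measurable_torus_of_tuple.
apply: (@le_trans _ _ ((uniform_prob (@ltr01 R) \x cube_prob R n)%E (U `*` setT))).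
  rewrite /torus_lebesgue /distribution /pushforward /=.
  apply: le_measure; rewrite ?inE.
  - by rewrite -[X in measurable X]setTI; exact: measurable_tuple_cons.
  - exact: measurableX.
  - move=> [x t] /= h; split=> //=.
    pose a : 'rV[R]_n.+1 := \row_i tnth (tuple_cons (x, t)) i.
    pose c : 'rV[R]_n.+1 := \row_i torus_coord u i.
    have uE : u = torus_proj c.
      rewrite -[LHS]torus_reprK; apply/torus_proj_eq/mxOverP => i j; rewrite !mxE !ord1.
      by rewrite /torus_coord opprB addrC subrK intr_int.
    move: h; rewrite /torus_of_tuple -/a uE -torus_projD g_proj mulrC ltr_pdivrMr ?ltr0n//.
    rewrite [e * _]mulrC; apply: le_lt_trans.
    rewrite big_ord_recl !mxE (tnth_nth 0)/= lerDl; exact: sumr_ge0.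
rewrite product_measure1E// [X in (_ * X)%E](_ : _ = 1%E) ?mule1; last exact: probability_setT.
apply: le_trans (uniform_prob01_sin_lt hb e0') _.
by rewrite lee_fin; lra.
Qed.

Lemma measurable_lne_g : measurable_fun setT (fun t : torus R D => lne (g t)%:E).
Proof.
rewrite (_ : (fun t => _) = (fun t : torus R D =>
    if g t <= 0 then -oo%E else (ln (g t))%:E)).
  apply: measurable_fun_ifT; last 2 first.
  - exact: measurable_cst.
  - apply/measurable_EFinP.
    exact: (measurableT_comp (@measurable_ln R) (@measurable_g R D)).
  by apply: measurable_fun_ler; [exact: measurable_g|exact: measurable_cst].
apply/funext => t; case: ifPn => h; first by rewrite le0_lneNy ?lee_fin.
by rewrite lne_EFin// ltNge.
Qed.

(** [kappa1] must be a real number above [kappa0], so [- ln g] has to be integrable: in its layer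
    cake the level [2^-j] has volume [O(2^-j)]. *)
Lemma kappa0_lty : (kappa0 R D < +oo)%E.
Proof.
rewrite /kappa0 -[ltRHS]/(expeR +oo) lte_expeR.
pose h (t : torus R D) := (- lne (g t)%:E)%E.
have h0 t : (0 <= h t)%E.
  rewrite /h leeNr oppe0; have [g0|g0] := leP (g t) 0; first by rewrite le0_lneNy ?lee_fin.
  by rewrite lne_EFin// lee_fin ln_le0// g_le1.
have mh : measurable_fun setT h by apply: measurableT_comp => //; exact: measurable_lne_g.
have -> : (\int[torus_lebesgue R D]_t lne (g t)%:E = - \int[torus_lebesgue R D]_t h t)%E.
  rewrite -integral_ge0N//; apply: eq_integral => t _; by rewrite /h oppeK.
rewrite oppeK.
have ln2 : 0 < ln 2 :> R by rewrite ln_gt0// ltr1n.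
pose f j (t : torus R D) := (ln 2 * \1_[set t | g t < 2^-1 ^+ j] t : R)%:E.
have f0 j t : (0 <= f j t)%E by rewrite lee_fin mulr_ge0// ltW.
have mf j : measurable_fun setT (f j).
  apply/measurable_EFinP; apply: measurable_funM; first exact: measurable_cst.
  by apply: measurable_indic; exact: measurable_g_lt.
apply: (@le_lt_trans _ _ (\int[torus_lebesgue R D]_t \big[+%E/0%R]_(0 <= j <oo) f j t)%E).
  apply: ge0_le_integral => //.
    by apply: ge0_emeasurable_sum.
  move=> t _.
  have hpart (J : nat) : ((ln 2 * \sum_(j < J) (g t < 2^-1 ^+ j)%R%:R)%:E <=
      \big[+%E/0%R]_(0 <= j <oo) f j t)%E.
    apply: le_trans (nneseries_lim_ge J (fun j _ _ => f0 j t)).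
    rewrite big_mkord /f sumEFin lee_fin -mulr_sumr ler_wpM2l ?(ltW ln2)//.
    by apply: ler_sum => j _; rewrite indicE mem_setE.
  (* At a zero of [g] the logarithm is infinite and every level is counted, so the series is
     infinite as well. *)
  have [g0|g0] := leP (g t) 0.
    rewrite (_ : \big[+%E/0%R]_(0 <= j <oo) f j t = +oo%E) ?leey//.
    apply/eqyP => A A0.
    have [J hJ] : exists J : nat, A / ln 2 <= J%:R.
      by exists (Num.bound (A / ln 2)); apply: ltW; apply: archi_boundP; rewrite divr_ge0// ltW.
    apply: le_trans (hpart J); rewrite lee_fin mulrC -ler_pdivrMr//; apply: le_trans hJ _.
    rewrite (eq_bigr (fun=> 1)) ?sumr_const ?card_ord// => j _.
    by rewrite (le_lt_trans g0) ?exprn_gt0 ?invr_gt0.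
  have [J _ /(_ J (leqnn J))] : \forall J \near \oo, `|2^-1 ^+ J : R| < g t.
    by apply: cvgr0_norm_lt => //; apply: cvg_expr; rewrite ger0_norm// invf_lt1// ltr1n.
  rewrite ger0_norm ?exprn_ge0 ?invr_ge0// => /ltW hJ.
  apply: le_trans (hpart J); rewrite /h lne_EFin// -EFinN lee_fin.
  exact: ln_layer_cake.
rewrite integral_nneseries//.
have hj j : (\int[torus_lebesgue R D]_t f j t <= (ln 2 * (6 * D%:R) * 2^-1 ^+ j)%:E)%E.
  rewrite /f; under eq_integral do rewrite EFinM.
  rewrite ge0_integralZl//; last 2 first.
  - by apply/measurable_EFinP; apply: measurable_indic; exact: measurable_g_lt.
  - by rewrite lee_fin ltW.
  rewrite integral_indic//; last exact: measurable_g_lt.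
  rewrite setIT -mulrA EFinM lee_pmul2l ?lte_fin//.
  have := @torus_lebesgue_g_lt 0 (2^-1 ^+ j) _.
  rewrite (_ : [set t | _] = [set t : torus R D | g t < 2^-1 ^+ j]); last first.
    by apply/seteqP; split=> t /=; rewrite addr0.
  by apply; rewrite exprn_gt0 ?invr_gt0.
have half01 : 0 <= (2^-1 : R) < 1 by apply/andP; split; lra.
have c0 : 0 <= ln 2 * (6 * D%:R) :> R by rewrite !mulr_ge0// ltW.
apply: (@le_lt_trans _ _ (ln 2 * (6 * D%:R) * (1 - 2^-1)^-1)%:E); last exact: ltry.
apply: lime_le.
  by apply: is_cvg_nneseries => j _ _; apply: integral_ge0 => t _; exact: f0.
apply: nearW => J; rewrite big_mkord.
apply: (@le_trans _ _ (\sum_(j < J) (ln 2 * (6 * D%:R) * 2^-1 ^+ j)%:E)%E).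
  by apply: lee_sum => j _; exact: hj.
by rewrite sumEFin lee_fin -mulr_sumr ler_wpM2l// geometric_sum_le.
Qed.

End Haar.

(** * Expansion probabilities of physical measures *)

Section ExpDecay.
Variable R : realType.

Lemma linear_expRN_le (a b : R) (n : nat) : 0 <= a -> 0 < b ->
  (1 + a * n%:R) * expR (- (b * n%:R)) <= (1 + 2 * a / b) * expR (- (b / 2 * n%:R)).
Proof.
move=> a0 b0.
have -> : b * n%:R = b / 2 * n%:R + b / 2 * n%:R by field.
rewrite opprD expRD mulrA; apply: ler_wpM2r; first exact: expR_ge0.
have n0 : 0 <= n%:R :> R by [].
set y := b / 2 * n%:R.
have y0 : 0 <= y by rewrite mulr_ge0// divr_ge0// ltW.
have ey := expR_ge1Dx y.
rewrite expRN ler_pdivrMr ?expR_gt0//.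
have -> : a * n%:R = 2 * a / b * y by rewrite /y; field; rewrite gt_eqF.
have k0 : 0 <= 2 * a / b by rewrite divr_ge0 ?mulr_ge0// ltW.
move: k0; set K := 2 * a / b => k0.
have h : K * y <= K * expR y by apply: ler_wpM2l => //; lra.
by rewrite (mulrDl 1 K) mul1r; lra.
Qed.

Lemma expRN_eventually_lt (K b e : R) (n0 : nat) : 0 <= K -> 0 < b -> 0 < e ->
  exists n, (n0 <= n)%N /\ K * expR (- (b * n%:R)) < e.
Proof.
move=> K0 b0 e0.
have h0 : 0 <= K / (b * e) by rewrite divr_ge0// mulr_ge0// ltW.
pose n := (maxn n0 (Num.bound (K / (b * e)))).
exists n; split; first exact: leq_maxl.
have hn : K / (b * e) < n%:R.
  by apply: lt_le_trans (archi_boundP h0) _; rewrite ler_nat leq_maxr.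
rewrite expRN ltr_pdivrMr ?expR_gt0//.
have he := expR_ge1Dx (b * n%:R).
move: hn; rewrite ltr_pdivrMr ?mulr_gt0// => hn.
have : e * (b * n%:R) < e * expR (b * n%:R) by rewrite ltr_pM2l//; lra.
by apply: lt_trans; rewrite (_ : e * (b * n%:R) = n%:R * (b * e))//; ring.
Qed.

End ExpDecay.

Lemma bigsetU_ordP (T : Type) (B : nat -> set T) (n : nat) (x : T) :
  (\big[setU/set0]_(k < n) B k) x <-> exists2 k, (k < n)%N & B k x.
Proof. by rewrite -bigcup_mkord; split=> [[k]|[k]]; exists k. Qed.

Lemma measure_setU_bigsetU_le d (T : measurableType d) (R : realType)
    (mu : measure T R) (B0 : set T) (B : nat -> set T) (n : nat) :
  measurable B0 -> (forall k, measurable (B k)) ->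
  (mu (B0 `|` \big[setU/set0]_(k < n) B k) <= mu B0 + \sum_(k < n) mu (B k))%E.
Proof.
move=> mB0 mB; apply: le_trans (measureU2 mu mB0 _) _.
  by apply: bigsetU_measurable => k _; exact: mB.
by apply: leeD => //; exact: (Boole_inequality mu (fun k _ => mB k)).
Qed.

(** * Estimates for a fixed large [kappa] *)

Section Estimates.
Variables (R : realType) (D : nat) (v : torus R D).
Variables (c d C : R).
Hypotheses (D_gt0 : (0 < D)%N) (irr_v : totally_irrational v).
Hypotheses (c_gt0 : 0 < c) (d_gt1 : 1 < d) (C_ge0 : 0 <= C).
Hypothesis g_orbit0 : forall n, (1 <= n)%N -> c * n%:R `^ (- d) <= g (v *+ n).
Hypothesis sum_orbit0 :
  forall n, \sum_(1 <= j < n.+1) - ln (g (v *+ j)) <= C * n%:R.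

Definition orbit_rate : R := C + ln 2.
Local Notation A := orbit_rate.
(** Half of [n] steps contracting by [2/3] yield [(2/3)^(n/2) = exp (- decay n)]. The same scale is
    the threshold for [x_0], so this contraction compensates the division by [x_0] in the derivative
    bound. *)
Definition decay : R := ln (3 / 2) / 2.
(** The sum of two requirements, so that both hold: the first two terms are the condition of
    [large_fibre_count] with rates [orbit_rate + decay] and [decay], the last bracket is the gain
    [orbit_rate + 2 + ln 2] needed in [orbit_fibre_ge]. *)
Definition ln_threshold : R :=
  ln 5 + 2 * (C + ln 2 + decay + decay + ln 2) + (C + ln 2 + 2 + ln 2).

Variable kappa : R.
Hypothesis kappa_ge : expR ln_threshold <= kappa.

Let ln2 : 0 < ln 2 :> R. Proof. by rewrite ln_gt0// ltr1n. Qed.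
Let ln5 : 0 < ln 5 :> R. Proof. by rewrite ln_gt0// ltr1n. Qed.

Lemma decay_gt0 : 0 < decay.
Proof. by rewrite divr_gt0// ln_gt0//; lra. Qed.

Let dl0 := decay_gt0.

Let A0 : 0 < A. Proof. by rewrite ltr_wpDl. Qed.

Let kappa_ge1 : 1 <= kappa.
Proof.
apply: le_trans kappa_ge; rewrite -expR0 ler_expR /ln_threshold.
by move: C_ge0 ln2 ln5 dl0; lra.
Qed.

Let kappa_gt0 : 0 < kappa. Proof. exact: lt_le_trans ltr01 kappa_ge1. Qed.

Let ln_kappa : ln_threshold <= ln kappa.
Proof. by rewrite -[leLHS]expRK ler_ln ?posrE ?expR_gt0. Qed.

Let g_orbit0_gt0 n : (1 <= n)%N -> 0 < g (v *+ n).
Proof.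
move=> n1; apply: lt_le_trans (g_orbit0 n1).
by rewrite mulr_gt0// powR_gt0// ltr0n.
Qed.

Implicit Types (p : torus R D * R) (k n N m : nat).

Lemma sum_ln_orbit_g p n M : 0 <= M ->
  (forall k, (k < n)%N -> expR (- M) <= orbit_g v p k) ->
  \sum_(0 <= k < n) - ln (orbit_g v p k) <= A * n%:R + M.
Proof. exact: sum_ln_orbit. Qed.

Definition regular n p : Prop :=
  expR (- (decay * n%:R)) <= p.2 /\
  forall k, (k < n)%N -> expR (- (decay * n%:R)) <= orbit_g v p k.

Lemma regular_count p n : phase p -> regular n p ->
  n%:R / 2 <= \sum_(0 <= k < n) (large_fibre kappa (orbit_fibre v kappa p) k)%:R :> R.
Proof.
move=> pp [hx hg].
have gpos k : (k < n)%N -> 0 < orbit_g v p k.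
  by move=> kn; apply: lt_le_trans (hg k kn); exact: expR_gt0.
have x0 : 0 < orbit_fibre v kappa p 0%N <= 1.
  rewrite (lt_le_trans _ hx) ?expR_gt0//=; by case/andP: pp.
apply: (@large_fibre_count _ _ (orbit_g v p) _ _ kappa_ge1 (orbit_g_le1 v p)
  (orbit_fibreS v kappa p) gpos x0 (A + decay) decay) => //.
- by rewrite addr_ge0// ltW.
- by move: ln_kappa C_ge0 ln2 ln5 dl0; rewrite /ln_threshold /orbit_rate; lra.
- rewrite mulrDl; apply: sum_ln_orbit_g => //.
  by rewrite mulr_ge0// ltW.
Qed.

Lemma regular_not_expanding p n : phase p -> regular n p ->
  orbit_deriv v kappa p n <= 1.
Proof.
move=> pp rp; have hI := regular_count pp rp; case: rp => hx hg.
have gpos k : (k < n)%N -> 0 < orbit_g v p k.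
  by move=> kn; apply: lt_le_trans (hg k kn); exact: expR_gt0.
have x0 : 0 < orbit_fibre v kappa p 0%N <= 1.
  rewrite (lt_le_trans _ hx) ?expR_gt0//=; by case/andP: pp.
exact: (@fibre_deriv_le1 _ _ (orbit_g v p) _ _ kappa_ge1 (orbit_g_le1 v p)
  (orbit_fibreS v kappa p) gpos x0 hI hx).
Qed.

(** Let [n] steps remain after the last time with [kappa * x >= 1]. They gain at least [(A + 2) n]
    and lose at most [A n + eta + n], the closest approach being bounded by its distance from the
    end. If there is no such time, then [n = m] and the surplus [m] pays for the starting value
    [exp (- m)]. *)
Lemma orbit_fibre_ge p m eta : 0 <= eta -> phase p -> expR (- m%:R) <= p.2 ->
  (forall k, (k < m)%N -> expR (- (eta + (m - k)%:R)) <= orbit_g v p k) ->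
  expR (- (eta + ln kappa)) <= orbit_fibre v kappa p m.
Proof.
move=> eta0 pp hx hg.
have gpos k : (k < m)%N -> 0 < orbit_g v p k.
  by move=> kn; apply: lt_le_trans (hg k kn); exact: expR_gt0.
have x0 : 0 < orbit_fibre v kappa p 0%N <= 1.
  rewrite (lt_le_trans _ hx) ?expR_gt0//=; by case/andP: pp.
have /andP[xm0 _] := fibre_itv kappa_ge1 (orbit_g_le1 v p) (orbit_fibreS v kappa p) gpos x0 (leqnn m).
have [k0 [y [k0m yP hy]]] := fibre_ln_ge kappa_ge1 (orbit_g_le1 v p)
  (orbit_fibreS v kappa p) gpos x0 (leqnn m).
rewrite -[leRHS]lnK ?posrE// ler_expR; apply: le_trans hy.
set n := (m - k0)%N.
have hs : \sum_(k0 <= k < m) - ln (orbit_g v p k) <= A * n%:R + (eta + n%:R).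
  rewrite -{1}[k0]add0n big_addn -/n.
  under eq_bigr do rewrite addnC -(orbit_g_iter v kappa).
  apply: sum_ln_orbit_g; first by rewrite addr_ge0.
  move=> k kn; rewrite orbit_g_iter.
  have kk : (k0 + k < m)%N by rewrite -ltn_subRL.
  apply: le_trans (hg _ kk); rewrite ler_expR lerN2 lerD2l ler_nat.
  by rewrite /n leq_sub2l// leq_addr.
have hlnk : A + 2 + ln 2 <= ln kappa.
  by move: ln_kappa C_ge0 ln2 ln5 dl0; rewrite /ln_threshold /orbit_rate; lra.
rewrite big_split/= sumr_const_nat -/n -[_ *+ n]mulr_natr.
move: hs; rewrite sumrN; set W := \sum_(k0 <= k < m) _ => hs.
have h2 : (A + 2) * n%:R <= (ln kappa - ln 2) * n%:R by apply: ler_wpM2r => //; lra.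
have lk0 : 0 <= ln kappa by exact: ln_ge0.
case: yP => [[-> k00]|->].
  have : - m%:R <= ln (p.2) by rewrite -[leLHS]expRK ler_ln ?posrE ?expR_gt0//; case/andP: x0.
  have nm : n%:R = m%:R :> R by rewrite /n k00 subn0.
  rewrite -[orbit_fibre v kappa p 0]/(p.2) nm in hs h2 *.
  move: hs h2; rewrite (mulrDl A 2 m%:R).
  by move: (A * m%:R) ((ln kappa - ln 2) * m%:R) => X Y; lra.
have n0 : 0 <= n%:R :> R by [].
move: hs h2; rewrite lnV ?posrE// (mulrDl A 2 n%:R).
by move: (A * n%:R) ((ln kappa - ln 2) * n%:R) => X Y; lra.
Qed.

(** The derivative is taken from [F p] on, past the tiny factor [g]. The first smallness condition
    puts the new fibre coordinate into the linear regime for [N] steps; the second keeps the next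
    [N] values of [g] above half of those along the orbit of [0]. *)
Lemma expanding_near_zero p N : (1 <= N)%N -> phase p ->
  orbit_g v p 0%N < 2^-1 / kappa ^+ N ->
  orbit_g v p 0%N < c * N%:R `^ (- d) / 2 ->
  1 < orbit_deriv v kappa (F v kappa p) N.
Proof.
move=> N1 pp h1 h2.
set q := F v kappa p.
have gq k : orbit_g v q k = orbit_g v p k.+1 by rewrite (orbit_g_iter v kappa p k 1).
have /andP[q0 q1] : phase q by exact: phaseF.
have NR : 0 < N%:R :> R by rewrite ltr0n.
have hg k : (k < N)%N -> g (v *+ k.+1) / 2 <= orbit_g v q k.
  move=> kN; rewrite gq.
  have h3 : g (v *+ k.+1) <= orbit_g v p k.+1 + orbit_g v p 0%N.
    rewrite /orbit_g mulr0n addr0.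
    by have := gB (p.1 + v *+ k.+1) p.1; rewrite addrAC subrr add0r.
  have h4 : c * N%:R `^ (- d) <= g (v *+ k.+1).
    apply: le_trans (g_orbit0 (ltn0Sn k)); rewrite ler_wpM2l ?(ltW c_gt0)//.
    rewrite !powRN lef_pV2 ?posrE ?powR_gt0 ?ltr0n//.
    by apply: ge0_ler_powR; rewrite ?nnegrE ?ler_nat//; exact: ltW (lt_trans ltr01 d_gt1).
  by move: h1 h2 h3 h4; lra.
have hpos k : (k < N)%N -> 0 < orbit_g v q k.
  by move=> kN; apply: lt_le_trans (hg k kN); rewrite divr_gt0// g_orbit0_gt0.
apply: (@fibre_deriv_gt1 _ _ (orbit_g v q) _ _ kappa_ge1 (orbit_g_le1 v q) (orbit_fibreS v kappa q)) => //.
- rewrite [orbit_fibre _ _ _ _]/= mulrC -ler_pdivlMr ?exprn_gt0//.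
  apply: le_trans (ltW h1); rewrite /orbit_g mulr0n addr0.
  by rewrite ler_piMl ?g_ge0 ?tanh_le1.
- by move=> k; exact: orbit_g_ge0.
- apply: (@le_lt_trans _ _ (A * N%:R)).
    apply: (@le_trans _ _ (\sum_(0 <= k < N) (ln 2 - ln (g (v *+ k.+1))))).
      rewrite [leLHS]big_nat_cond [leRHS]big_nat_cond; apply: ler_sum => k /andP[/andP[_ kN] _].
      have g0 := g_orbit0_gt0 (ltn0Sn k).
      have : ln (g (v *+ k.+1) / 2) <= ln (orbit_g v q k).
        by rewrite ler_ln ?posrE ?hg ?hpos// divr_gt0.
      by rewrite ln_div ?posrE//; lra.
    rewrite big_split/= sumr_const_nat subn0 -[_ *+ N]mulr_natr /orbit_rate mulrDl addrC lerD2r.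
    by have := sum_orbit0 N; rewrite big_add1.
  rewrite [ltLHS]mulrC ltr_pM2l//.
  by move: ln_kappa C_ge0 ln2 ln5 dl0; rewrite /ln_threshold /orbit_rate; lra.
Qed.

(** The factor [g] of the first step is kept and all others are bounded by [kappa]: starts near the
    zero of [g] do not expand, which separates the probability from [1] for each [N]. *)
Lemma orbit_deriv_le p N : (1 <= N)%N -> phase p ->
  orbit_deriv v kappa p N <= kappa ^+ N * orbit_g v p 0%N.
Proof.
move=> + pp.
have f0 k : 0 <= kappa * sech2 (kappa * orbit_fibre v kappa p k) * orbit_g v p k.
  apply: mulr_ge0; last exact: orbit_g_ge0.
  by apply: mulr_ge0; apply: ltW => //; exact: sech2_gt0.
have fk k : kappa * sech2 (kappa * orbit_fibre v kappa p k) <= kappa.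
  by rewrite ler_piMr ?(ltW kappa_gt0)// sech2_le1.
rewrite /orbit_deriv /fibre_deriv; elim: N => // -[|N] IH _.
  by rewrite big_nat1 expr1 ler_wpM2r ?orbit_g_ge0.
rewrite big_nat_recr//= exprSr [leRHS]mulrAC; apply: ler_pM; last 2 first.
- exact: IH.
- apply: le_trans (fk N.+1).
  rewrite ler_piMr ?orbit_g_le1//.
  by apply: mulr_ge0; apply: ltW => //; exact: sech2_gt0.
- by apply: prodr_ge0 => k _; exact: f0.
- exact: f0.
Qed.


Definition irregular n : set (torus R D * R) := [set p | phase p /\ ~ regular n p].

Lemma irregularE n : irregular n =
  (@phase R D `&` [set p | p.2 < expR (- (decay * n%:R))]) `|`
  \big[setU/set0]_(k < n)
    (@phase R D `&` [set p | orbit_g v p k < expR (- (decay * n%:R))]).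
Proof.
set e := expR _.
pose B k : set (torus R D * R) := @phase R D `&` [set p | orbit_g v p k < e].
have BP := bigsetU_ordP B n; apply/seteqP; split=> p.
  move=> [pp nr]; have [h|h] := ltP p.2 e; first by left.
  right; apply/BP; apply: contrapT => nk; apply: nr; split=> // k kn.
  by rewrite leNgt; apply/negP => h2; apply: nk; exists k.
move=> [[pp /= h]|/BP[k kn [pp /= h]]]; split=> // -[h1 h2].
  by move: h; rewrite ltNge h1.
by move: h; rewrite ltNge h2.
Qed.

Let mphase : measurable (@phase R D) := @measurable_phase R D.

Lemma measurable_snd_lt (e : R) : measurable [set p : torus R D * R | p.2 < e].
Proof. exact: (@measurable_orbit_fibre_lt R D v kappa 0 e). Qed.

Let mx n : measurable (@phase R D `&` [set p | p.2 < expR (- (decay * n%:R))]).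
Proof. by apply: measurableI => //; exact: measurable_snd_lt. Qed.

Let mg n k : measurable (@phase R D `&` [set p | orbit_g v p k < expR (- (decay * n%:R))]).
Proof. by apply: measurableI => //; exact: measurable_orbit_g_lt. Qed.

Lemma measurable_irregular n : measurable (irregular n).
Proof.
rewrite irregularE; apply: measurableU; first exact: mx.
by apply: bigsetU_measurable => k _; exact: mg.
Qed.

Local Notation leb := (torus_lebesgue R D \x @lebesgue_measure R)%E.

Lemma lebesgue_irregular n :
  (leb (irregular n) <= ((1 + 6 * D%:R * n%:R) * expR (- (decay * n%:R)))%:E)%E.
Proof.
have h := @measure_setU_bigsetU_le _ (torus R D * measurableTypeR R)%type R
  (torus_lebesgue R D \x @lebesgue_measure R)%E _ _ n (mx n) (mg n).
rewrite irregularE; apply: (le_trans h); rewrite {h}; set e := expR _.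
have e0 : 0 < e by exact: expR_gt0.
have h1 : (leb (@phase R D `&` [set p | (p.2 < e)%R]) <= e%:E)%E.
  apply: (@le_trans _ _ (leb (setT `*` `[0%R, e]%classic))).
    apply: le_measure; [apply/mem_set|apply/mem_set|].
    - exact: mx.
    - apply: measurableX; [exact: measurableT|exact: measurable_itv].
    - by move=> p [/andP[p0 p1] /= pe]; split=> //=; rewrite in_itv/= p0 ltW.
  rewrite product_measure1E//.
  rewrite [X in (X * _)%E](_ : _ = 1%E) ?mul1e; last exact: probability_setT.
  have hl : (lebesgue_measure (`[0%R, e]%classic : set R) <= e%:E)%E.
    by rewrite lebesgue_measure_itv/= lte_fin e0 -EFinB subr0.
  exact: hl.
have h2 k : (leb (@phase R D `&` [set p | (orbit_g v p k < e)%R]) <= (6 * D%:R * e)%:E)%E.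
  have mS : measurable [set t : torus R D | g (t + v *+ k) < e].
    have mF := @measurable_torus_addr R D (v *+ k).
    have mS0 := @measurable_g_lt R D e.
    have h := mF measurableT _ mS0; by rewrite setTI in h.
  apply: (@le_trans _ _ (leb ([set t | g (t + v *+ k) < e] `*` `[0%R, 1%R]%classic))).
    apply: le_measure; [apply/mem_set|apply/mem_set|].
    - exact: mg.
    - apply: measurableX; [exact: mS|exact: measurable_itv].
    - by move=> p [/andP[p0 p1] /= pe]; split=> //=; rewrite in_itv/= p0.
  rewrite product_measure1E//.
  have hl : lebesgue_measure (`[0%R, 1%R]%classic : set R) = 1%E.
    by rewrite lebesgue_measure_itv/= lte_fin ltr01 -EFinB subr0.
  rewrite [X in (_ * X)%E](_ : _ = 1%E) ?mule1; last exact: hl.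
  exact: torus_lebesgue_g_lt.
apply: (@le_trans _ _ (e%:E + \sum_(k < n) (6 * D%:R * e)%:E)%E).
  by apply: leeD; [exact: h1|apply: lee_sum => k _; exact: h2].
rewrite sumEFin sumr_const card_ord -EFinD lee_fin -[_ *+ n]mulr_natr.
by rewrite [leRHS]mulrDl mul1r lerD2l mulrAC.
Qed.

(** * The zero section under a physical measure *)

Variable P : probability (torus R D * R)%type R.
Hypothesis P_phys : physical_measure v kappa P.

Let P_phase : P (@phase R D) = 1%E. Proof. by have [] := P_phys. Qed.
Let P_inv : invariant_measure v kappa P. Proof. by have [] := P_phys. Qed.

Definition zero_fibre n : set (torus R D * R) :=
  @phase R D `&` [set p | orbit_fibre v kappa p n = 0].

Let mz n : measurable [set p : torus R D * R | orbit_fibre v kappa p n = 0].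
Proof.
rewrite (_ : [set p | _] = (orbit_fibre v kappa ^~ n) @^-1` [set 0]).
  by rewrite -[X in measurable X]setTI; exact: measurable_orbit_fibre.
by apply/seteqP; split.
Qed.

Lemma measurable_zero_fibre n : measurable (zero_fibre n).
Proof. by apply: measurableI => //; exact: mz. Qed.

Lemma prob_zero_fibre n : P (zero_fibre n) = P (zero_fibre 0).
Proof.
transitivity (P [set p : torus R D * R | orbit_fibre v kappa p n = 0]).
  exact: (prob_phaseI P_phase (mz n)).
transitivity (P [set p : torus R D * R | orbit_fibre v kappa p 0 = 0]).
  exact: (prob_iterF kappa_ge1 P_phase P_inv n (mz 0)).
exact/esym/(prob_phaseI P_phase (mz 0)).
Qed.

Lemma zero_fibre_homo : {homo zero_fibre : n m / (n <= m)%N >-> n `<=` m}.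
Proof.
move=> n m nm p [pp /= h]; split=> //=; rewrite -(subnKC nm).
by elim: (m - n)%N => [|k IH]; rewrite ?addn0// addnS orbit_fibreS IH mulr0 tanh0 mul0r.
Qed.

(** The section [x = 0] may differ from its preimage, because zeros of [g] send whole fibres into
    it. The increasing union of its preimages is exactly invariant and has the same measure, so
    ergodicity applies to it. *)
Lemma prob_zero_fibre01 : P (zero_fibre 0) = 0%E \/ P (zero_fibre 0) = 1%E.
Proof.
have mU : measurable (\bigcup_n zero_fibre n).
  by apply: bigcupT_measurable => n; exact: measurable_zero_fibre.
have PU : P (\bigcup_n zero_fibre n) = P (zero_fibre 0).
  have := @nondecreasing_cvg_mu _ _ _ P zero_fibre measurable_zero_fibre mU.
  move=> /(_ _)/cvg_lim <-//.
    rewrite (_ : P \o zero_fibre = cst (P (zero_fibre 0))) ?lim_cst//.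
    by apply/funext => n /=; rewrite prob_zero_fibre.
  by move=> n m nm; apply/subsetPset; exact: zero_fibre_homo.
rewrite -PU; have [_ _ P_erg _] := P_phys; apply: P_erg => //.
  by move=> p [n _ []].
have step p n : orbit_fibre v kappa (F v kappa p) n = orbit_fibre v kappa p n.+1.
  by rewrite /orbit_fibre iterSr.
apply/seteqP; split=> p.
  by move=> [pp [n _ [_ /= h]]]; exists n.+1 => //; split=> //=; rewrite -step.
move=> [n _ [pp /= h]]; split=> //; exists n => //; split; first exact: phaseF.
by rewrite /= step orbit_fibreS h mulr0 tanh0 mul0r.
Qed.

(* If [P] lived on [x = 0], the time averages of [x] would tend to [0] on a set
   of positive Lebesgue measure; but they are at least [2 / kappa] outside the
   irregular sets, whose Lebesgue measures tend to [0]. *)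
Lemma prob_zero_fibre_eq0 : P (zero_fibre 0) = 0%E.
Proof.
have [//|P1] := prob_zero_fibre01; exfalso.
have [_ _ _ [V [mV Vphase V0 hV]]] := P_phys.
have cf : {within @phase R D, continuous (snd : torus R D * R -> R)}.
  by apply: continuous_subspaceT => p; exact: cvg_snd.
pose L := \int[P]_(q in @phase R D) q.2.
have mC : measurable (~` [set p : torus R D * R | orbit_fibre v kappa p 0 = 0]).
  by apply: measurableC; exact: mz.
have L0 : L <= 0.
  rewrite /L /Rintegral -lee_fin.
  have int0 : (\int[P]_(q in @phase R D) (q.2)%:E <= 0)%E.
    (* As [x <= 1], the coordinate is dominated by the indicator of [x != 0], a null set by [P1]. *)
    apply: (@le_trans _ _ (\int[P]_(q in @phase R D)
        (\1_(~` [set p | orbit_fibre v kappa p 0 = 0]) q)%:E)%E).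
      apply: ge0_le_integral => //.
      - by move=> q /andP[q0 _]; rewrite lee_fin.
      - by apply/measurable_EFinP; apply: measurable_funTS; exact: measurable_snd.
      - by apply/measurable_EFinP; apply: measurable_funTS; exact: measurable_indic.
      - move=> q /andP[_ q1]; rewrite lee_fin indicE.
        case: (boolP (q \in _)) => // /negP nq; rewrite leNgt; apply/negP => q0; apply: nq.
        by apply/mem_set => /= h; move: q0; rewrite -[q.2]/(orbit_fibre v kappa q 0) h ltxx.
    rewrite integral_indic//.
    apply: (@le_trans _ _ (P (~` [set p | orbit_fibre v kappa p 0 = 0]))).
      by apply: le_measure; rewrite ?inE//; exact: measurableI.
    rewrite probability_setC; last exact: mz.
    by rewrite -(prob_phaseI P_phase (mz 0)) -/(zero_fibre 0) P1 subee.
  have int_ge0 : (0 <= \int[P]_(q in @phase R D) (q.2)%:E)%E.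
    by apply: integral_ge0 => q /andP[q0 _]; rewrite lee_fin.
  have -> : (\int[P]_(q in @phase R D) (q.2)%:E = 0)%E.
    by apply/eqP; rewrite eq_le int0 int_ge0.
  by [].
have irr p : V p -> exists m, forall n, (m <= n)%N -> irregular n p.
  move=> Vp; have pp := Vphase _ Vp.
  have h := hV _ cf p Vp; rewrite -/L in h.
  (* On a regular orbit half of the times have [x >= 4 / kappa], so the average of [x] is at least
     [2 / kappa]. *)
  have Lk : L < 2 / kappa by apply: le_lt_trans L0 _; rewrite divr_gt0.
  have [m _ hm] : \forall n \near \oo,
      n%:R^-1 * \sum_(0 <= l < n) (iter l (F v kappa) p).2 < 2 / kappa.
    exact: (cvgr_lt _ h _ Lk).
  exists m.+1 => n mn; split=> // rn; have := hm n (ltnW mn) => /=.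
  apply/negP; rewrite -leNgt.
  have n0 : 0 < n%:R :> R by rewrite ltr0n (leq_trans _ mn).
  rewrite -[leRHS]/(_^-1 * _) mulrC -[n%:R^-1 * _]mulrC ler_pdivlMr//.
  have := regular_count pp rn => hc.
  apply: (@le_trans _ _ (4 / kappa * \sum_(0 <= k < n) (large_fibre kappa (orbit_fibre v kappa p) k)%:R)).
    apply: (@le_trans _ _ (4 / kappa * (n%:R / 2))); last by rewrite ler_wpM2l// divr_ge0// ltW.
    by rewrite le_eqVlt; apply/orP; left; apply/eqP; field; rewrite gt_eqF.
  rewrite mulr_sumr; apply: ler_sum => l _.
  rewrite /large_fibre; case: (leP 4 _) => h4 /=.
    by rewrite mulr1 ler_pdivrMr// mulrC.
  rewrite mulr0; elim: l {h4} => [|l IH]; first by case/andP: pp.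
  by rewrite iterS/= mulr_ge0 ?g_ge0// tanh_ge0// mulr_ge0// ltW.
have Vsub : V `<=` \bigcup_m \bigcap_n irregular (m + n).
  move=> p Vp; have [m hm] := irr p Vp.
  by exists m => // n _; apply: hm; rewrite leq_addr.
(* For each [m] the intersection lies in [irregular n] for arbitrarily large [n], hence is null. *)
have neg : leb.-negligible (\bigcup_m \bigcap_n irregular (m + n)).
  apply: negligible_bigcup => m.
  have mI : measurable (\bigcap_n irregular (m + n)).
    by apply: bigcapT_measurable => n; exact: measurable_irregular.
  apply/negligibleP => //; apply/eqP; rewrite eq_le measure_ge0 andbT.
  apply/lee_addgt0Pr => e e0; rewrite add0e.
  have D6 : 0 <= 6 * D%:R :> R by [].
  have K0 : 0 <= 1 + 2 * (6 * D%:R) / decay by rewrite addr_ge0// divr_ge0// ltW.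
  have b0 : 0 < decay / 2 by rewrite divr_gt0.
  have [n [mn hn]] := @expRN_eventually_lt R _ _ e m K0 b0 e0.
  apply: (@le_trans _ _ (leb (irregular n))).
    apply: le_measure; [exact: mem_set mI|apply/mem_set; exact: measurable_irregular|].
    by move=> p /(_ (n - m)%N I); rewrite subnKC.
  apply: le_trans (lebesgue_irregular n) _; rewrite lee_fin.
  by apply: le_trans (ltW hn); apply: linear_expRN_le.
have negV := @negligibleS _ (torus R D * measurableTypeR R)%type R _ _ V Vsub neg.
have V00 := @measure_negligible _ (torus R D * measurableTypeR R)%type R _ V mV negV.
by move: V0; rewrite [X in (_ < X)%E](_ : _ = 0%E) ?ltxx//; exact: V00.
Qed.


(** * Tails of the fibre coordinate and the upper bound *)

Let s0 : 0 < d^-1. Proof. by rewrite invr_gt0 (lt_trans ltr01 d_gt1). Qed.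

Definition ball_const : R := 2 * (c / 2) `^ (- d^-1).

Let ball_const_gt0 : 0 < ball_const.
Proof. by rewrite mulr_gt0// powR_gt0// divr_gt0. Qed.

Lemma prob_orbit_g_lt k (M : R) :
  (P [set p | (orbit_g v p k < expR (- M))%R] <= (ball_const * expR (- (d^-1 * M)))%:E)%E.
Proof.
rewrite (prob_orbit_g kappa_ge1 P_phase P_inv) -mulNr.
exact: (prob_g_lt_le (base_marginal_inv kappa_ge1 P_phase P_inv)).
Qed.

(** Continuity from above at the null set [x = 0]. It gives no rate, but it only has to control the
    remote start of an orbit. *)
Lemma prob_phase_fibre_lt_small (e : R) : 0 < e ->
  exists m, (P (@phase R D `&` [set p | (p.2 < expR (- m%:R))%R]) <= e%:E)%E.
Proof.
move=> e0.
pose B m : set (torus R D * R) := @phase R D `&` [set p | p.2 < expR (- m%:R)].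
have mB m : measurable (B m) by apply: measurableI => //; exact: measurable_snd_lt.
have capB : \bigcap_m B m = zero_fibre 0.
  apply/seteqP; split=> p.
    move=> h; have [pp _] := h 0%N I; split=> //=.
    have /andP[p0 p1] := pp; apply/eqP; rewrite eq_le p0 andbT leNgt; apply/negP => p2.
    have [m [_ hm]] := @expRN_eventually_lt R 1 1 p.2 0 ler01 ltr01 p2.
    by have [_ /=] := h m I; move: hm; rewrite !mul1r => /lt_trans h1 /h1; rewrite ltxx.
  move=> [pp /= p0] m _; split=> //=.
  by rewrite -[p.2]/(orbit_fibre v kappa p 0) p0 expR_gt0.
have cvgB : P (B m) @[m --> \oo] --> 0%E.
  rewrite -prob_zero_fibre_eq0 -capB; apply: nonincreasing_cvg_mu => //.
  - by rewrite ltey_eq fin_num_measure.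
  - exact: bigcapT_measurable.
  - move=> n m nm; apply/subsetPset => p [pp /= h]; split=> //=.
    by apply: lt_le_trans h _; rewrite ler_expR lerN2 ler_nat.
have [m _ /(_ m (leqnn m)) hm] := cvgB _ (@nbhs_open_ereal_lt R 0 (cst e) e0).
by exists m; exact: ltW.
Qed.

Definition fibre_const : R := ball_const / (1 - expR (- d^-1)).

Let expRs01 : 0 <= expR (- d^-1) < 1.
Proof. by rewrite expR_ge0 expR_lt1 oppr_lt0. Qed.

(** By invariance [x] has the law of the fibre coordinate at time [m]. Outside an event of mass
    [eps] the start is at least [exp (- m)], and then [orbit_fibre_ge] blames a small end value on
    some time [k] with [g < exp (- (eta + m - k))]. These masses sum to a geometric series
    independent of [m], and [eps] is arbitrary. *)
Lemma prob_fibre_lt (eta : R) : 0 <= eta ->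
  (P [set p | (p.2 < expR (- (eta + ln kappa)))%R] <=
    (fibre_const * expR (- (d^-1 * eta)))%:E)%E.
Proof.
move=> eta0; set e := expR (- (eta + ln kappa)).
apply/lee_addgt0Pr => eps eps0.
have [m hm] := prob_phase_fibre_lt_small eps0.
rewrite -(prob_orbit_fibre kappa_ge1 P_phase P_inv m).
rewrite -(prob_phaseI P_phase (measurable_orbit_fibre_lt v kappa m e)).
pose B0 : set (torus R D * R) := @phase R D `&` [set p | p.2 < expR (- m%:R)].
pose B k : set (torus R D * R) := [set p | orbit_g v p k < expR (- (eta + (m - k)%:R))].
have mB0 : measurable B0 by apply: measurableI => //; exact: measurable_snd_lt.
have mB k : measurable (B k) by exact: measurable_orbit_g_lt.
apply: (@le_trans _ _ (P (B0 `|` \big[setU/set0]_(k < m) B k))).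
  apply: le_measure; [apply/mem_set|apply/mem_set|].
  - by apply: measurableI => //; exact: measurable_orbit_fibre_lt.
  - by apply: measurableU => //; apply: bigsetU_measurable => k _.
  - move=> p [pp /= h].
    have [h2|h2] := ltP p.2 (expR (- m%:R)); first by left.
    right; apply/bigsetU_ordP; apply: contrapT => nk.
    move: h; rewrite ltNge orbit_fibre_ge// => k km.
    by rewrite leNgt; apply/negP => h3; apply: nk; exists k.
apply: (le_trans (measure_setU_bigsetU_le P m mB0 mB)).
rewrite addeC; apply: leeD => //.
apply: (@le_trans _ _ (\sum_(k < m) (ball_const * expR (- (d^-1 * (eta + (m - k)%:R))))%:E)%E).
  by apply: lee_sum => k _; exact: prob_orbit_g_lt.
rewrite sumEFin lee_fin /fibre_const mulrAC.
have -> : \sum_(k < m) ball_const * expR (- (d^-1 * (eta + (m - k)%:R))) =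
    ball_const * expR (- (d^-1 * eta)) * \sum_(k < m) expR (- d^-1) ^+ k.+1.
  rewrite mulr_sumr (reindex_inj rev_ord_inj)/=; apply: eq_bigr => k _.
  rewrite subKn// -expRM_natl -mulrA -expRD; congr (_ * expR _).
  by rewrite mulrDr opprD; congr (_ + _); rewrite mulrC mulrN mulrC.
apply: ler_wpM2l; first by rewrite mulr_ge0 ?expR_ge0// ltW.
apply: le_trans (geometric_sum_le m expRs01).
case/andP: expRs01 => r0 r1.
by apply: ler_sum => k _; rewrite exprS ler_piMl ?exprn_ge0// ltW.
Qed.

Definition decay_rate : R := d^-1 * decay.
Definition upper_const : R :=
  (1 + fibre_const) * expR (d^-1 * ln kappa) + ball_const.

Let fibre_const_ge0 : 0 <= fibre_const.
Proof.
by case/andP: expRs01 => _ r1; rewrite divr_ge0// ?subr_ge0; exact: ltW.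
Qed.

Lemma prob_fibre_lt_decay N :
  (P [set p | (p.2 < expR (- (decay * N%:R)))%R] <=
    ((1 + fibre_const) * expR (d^-1 * ln kappa) * expR (- (decay_rate * N%:R)))%:E)%E.
Proof.
rewrite -mulrA -expRD /decay_rate.
have -> : d^-1 * ln kappa - d^-1 * decay * N%:R = - (d^-1 * (decay * N%:R - ln kappa)) by ring.
set eta := decay * N%:R - ln kappa.
have [h|h] := leP 0 eta.
  have -> : decay * N%:R = eta + ln kappa by rewrite /eta subrK.
  apply: le_trans (prob_fibre_lt h) _; rewrite lee_fin; apply: ler_wpM2r; first exact: expR_ge0.
  by rewrite lerDr.
(* While [decay * N < ln kappa] the right-hand side is at least [1], owing to the summand [1] beside
   [fibre_const]. *)
apply: (@le_trans _ _ 1%E); first by apply: probability_le1; exact: measurable_snd_lt.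
rewrite lee_fin mulr_ege1 ?lerDl// -expR0 ler_expR oppr_ge0.
by rewrite pmulr_rle0// ltW.
Qed.

Lemma prob_expanding_decay N : (1 <= N)%N ->
  (prob_expanding v kappa P N <=
    (upper_const * (1 + 2 / decay_rate) * expR (- (decay_rate / 2 * N%:R)))%:E)%E.
Proof.
move=> N1.
have rate0 : 0 < decay_rate by rewrite mulr_gt0.
apply: (@le_trans _ _ (P (irregular N))).
  apply: le_measure; [apply/mem_set|apply/mem_set|].
  - exact: measurable_expanding.
  - exact: measurable_irregular.
  - move=> p [pp]; rewrite lyapunov_gt0// => h; split=> // /(regular_not_expanding pp).
    by rewrite leNgt h.
have h1 : (P (@phase R D `&` [set p | (p.2 < expR (- (decay * N%:R)))%R]) <=
    ((1 + fibre_const) * expR (d^-1 * ln kappa) * expR (- (decay_rate * N%:R)))%:E)%E.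
  by rewrite (prob_phaseI P_phase) ?prob_fibre_lt_decay//; exact: measurable_snd_lt.
have h2 k : (P (@phase R D `&` [set p | (orbit_g v p k < expR (- (decay * N%:R)))%R]) <=
    (ball_const * expR (- (decay_rate * N%:R)))%:E)%E.
  rewrite (prob_phaseI P_phase); last exact: measurable_orbit_g_lt.
  by have := prob_orbit_g_lt k (decay * N%:R); rewrite mulrA.
rewrite irregularE; apply: (le_trans (measure_setU_bigsetU_le P N (mx N) (mg N))).
apply: (@le_trans _ _ (((1 + fibre_const) * expR (d^-1 * ln kappa) *
    expR (- (decay_rate * N%:R)))%:E +
    \sum_(k < N) (ball_const * expR (- (decay_rate * N%:R)))%:E)%E).
  apply: leeD; first exact: h1.
  by apply: lee_sum => k _; exact: h2.
rewrite sumEFin sumr_const card_ord -EFinD lee_fin -[(_ * _) *+ N]mulr_natr.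
have U0 : 0 <= (1 + fibre_const) * expR (d^-1 * ln kappa).
  by rewrite mulr_ge0 ?expR_ge0// addr_ge0.
have uc0 : 0 <= upper_const by rewrite /upper_const addr_ge0// ltW.
have h : (1 + N%:R) * expR (- (decay_rate * N%:R)) <=
    (1 + 2 / decay_rate) * expR (- (decay_rate / 2 * N%:R)).
  by have := @linear_expRN_le R 1 decay_rate N ler01 rate0; rewrite mul1r mulr1.
apply: (@le_trans _ _ (upper_const * ((1 + N%:R) * expR (- (decay_rate * N%:R))))); last first.
  by apply: le_trans (ler_wpM2l uc0 h) _; rewrite mulrA.
have e0 := expR_ge0 (- (decay_rate * N%:R)).
have n0 : 0 <= N%:R :> R by [].
rewrite /upper_const.
move: U0 (ltW ball_const_gt0) e0 n0.
move: ((1 + fibre_const) * expR (d^-1 * ln kappa)) => U.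
move: (expR (- (decay_rate * N%:R))) => E.
move: ball_const (N%:R) => B n U0 B0 E0 n0.
have := mulr_ge0 B0 E0; have := mulr_ge0 (mulr_ge0 U0 n0) E0.
lra.
Qed.

Lemma prob_expanding_lt1 N : (1 <= N)%N ->
  (prob_expanding v kappa P N <=
    (1 - 2^-1 * ((kappa ^- N) ^+ 2 / (5 * D%:R)) ^+ D)%:E)%E.
Proof.
move=> N1; set r := kappa ^- N.
have kN0 : 0 < kappa ^+ N by rewrite exprn_gt0.
have r01 : 0 < r <= 1 by rewrite invr_gt0 kN0/= invf_le1// exprn_ege1.
pose S := [set p | orbit_g v p 0 < r].
have mS : measurable S by exact: measurable_orbit_g_lt.
apply: (@le_trans _ _ (P (~` S))).
  apply: le_measure; [apply/mem_set|apply/mem_set|].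
  - exact: measurable_expanding.
  - exact: measurableC.
  - move=> p [pp]; rewrite lyapunov_gt0// => h /= hr.
    have := lt_le_trans h (orbit_deriv_le N1 pp).
    by rewrite mulrC -ltr_pdivrMr// mul1r -/r ltNge (ltW hr).
rewrite probability_setC// EFinB leeB//.
rewrite /S (prob_orbit_g kappa_ge1 P_phase P_inv).
exact: (prob_g_lt_ge (base_marginal_inv kappa_ge1 P_phase P_inv)).
Qed.

(** Chosen so that [exp (- escape_rate N)] lies below both thresholds of [expanding_near_zero]; [d]
    and the absolute value handle [c N^-d / 2], using [ln N <= N] and [N >= 1]. *)
Definition escape_rate : R := ln kappa + ln 2 + d + `|ln 2 - ln c|.

Lemma prob_expanding_ge N : (1 <= N)%N ->
  ((2^-1 * (expR (- (escape_rate * N%:R)) ^+ 2 / (5 * D%:R)) ^+ D)%:E <=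
    prob_expanding v kappa P N)%E.
Proof.
move=> N1; set r := expR _.
have lk0 : 0 <= ln kappa by exact: ln_ge0.
have N1R : 1 <= N%:R :> R by rewrite ler1n.
have N0R : 0 < N%:R :> R by rewrite ltr0n.
have d0 : 0 < d by exact: lt_trans ltr01 d_gt1.
have esc0 : 0 <= escape_rate by rewrite /escape_rate !addr_ge0// ltW.
have r01 : 0 < r <= 1 by rewrite expR_gt0 expR_le1 oppr_le0 mulr_ge0.
have r1 : r <= 2^-1 / kappa ^+ N.
  have kN0 : 0 < kappa ^+ N by rewrite exprn_gt0.
  rewrite -[leRHS]lnK ?posrE ?divr_gt0// ler_expR ln_div ?posrE// lnV ?posrE// lnXn//.
  rewrite -[_ *+ N]mulr_natr /escape_rate.
  have : ln 2 <= ln 2 * N%:R :> R by rewrite ler_peMr// ltW.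
  have : 0 <= d * N%:R by rewrite mulr_ge0// ltW.
  have : 0 <= `|ln 2 - ln c| * N%:R by rewrite mulr_ge0.
  by lra.
have r2 : r <= c * N%:R `^ (- d) / 2.
  have Nd0 : 0 < N%:R `^ (- d) by rewrite powR_gt0.
  rewrite -[leRHS]lnK ?posrE ?divr_gt0 ?mulr_gt0// ler_expR ln_div ?posrE ?mulr_gt0//.
  rewrite lnM ?posrE// ln_powR /escape_rate.
  have lN : ln N%:R <= N%:R :> R by rewrite -ler_expR lnK ?posrE//; have := expR_ge1Dx (N%:R : R); lra.
  have h1 : d * ln N%:R <= d * N%:R :> R by rewrite ler_wpM2l// ltW.
  have h2 : ln 2 - ln c <= `|ln 2 - ln c| * N%:R.
    by apply: le_trans (ler_norm _) _; rewrite ler_peMr.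
  have : 0 <= ln kappa * N%:R by rewrite mulr_ge0.
  have : 0 <= ln 2 * N%:R :> R by rewrite mulr_ge0// ltW.
  by lra.
have mE := measurable_expanding v kappa N1.
rewrite /prob_expanding -(prob_F kappa_ge1 P_phase P_inv mE).
pose S := [set p | orbit_g v p 0 < r].
have mS : measurable S by exact: measurable_orbit_g_lt.
apply: (@le_trans _ _ (P S)).
  rewrite /S (prob_orbit_g kappa_ge1 P_phase P_inv).
  exact: (prob_g_lt_ge (base_marginal_inv kappa_ge1 P_phase P_inv)).
rewrite -(prob_phaseI P_phase mS).
apply: le_measure; [apply/mem_set|apply/mem_set|].
- exact: measurableI.
- by rewrite -[X in measurable X]setTI; exact: measurable_F.
- move=> p [pp /= hr]; split; first exact: phaseF.
  rewrite lyapunov_gt0//; apply: expanding_near_zero => //.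
  + exact: lt_le_trans hr r1.
  + exact: lt_le_trans hr r2.
Qed.

End Estimates.

(** Half of the rate [b] absorbs [K] for large [N]; the finitely many other [N] use
    [1 - q N <= exp (- q N)] and a minimum of rates. Since [x] is quantified after [gam], one rate
    serves all physical measures at once. *)
Lemma exp_decay_of_eventual (R : realType) (K b : R) (q : nat -> R) :
  0 < b -> (forall N, (1 <= N)%N -> 0 < q N) ->
  exists gam : R, 0 < gam /\ forall (N : nat) (x : R), (1 <= N)%N ->
    x <= K * expR (- (b * N%:R)) -> x <= 1 - q N -> x <= expR (- gam * N%:R).
Proof.
move=> b0 q0.
have small (n : nat) : exists gam : R, 0 < gam /\ forall N, (1 <= N <= n)%N ->
    1 - q N <= expR (- gam * N%:R).
  elim: n => [|n [gam [gam0 IH]]].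
    by exists 1; split=> // N /andP[N1]; rewrite leqNgt N1.
  have n0 : 0 < n.+1%:R :> R by rewrite ltr0n.
  have qn0 : 0 < q n.+1 / n.+1%:R by rewrite divr_gt0// q0.
  exists (Num.min gam (q n.+1 / n.+1%:R)); split; first by rewrite lt_min gam0.
  move=> N /andP[N1]; rewrite leq_eqVlt => /orP[/eqP ->|Nn].
    apply: le_trans (_ : expR (- q n.+1) <= _).
      by have := expR_ge1Dx (- q n.+1); lra.
    rewrite ler_expR mulNr lerN2 -ler_pdivlMr//.
    by rewrite ge_min lexx orbT.
  apply: le_trans (IH N _) _; first by rewrite N1.
  by rewrite ler_expR !mulNr lerN2 ler_wpM2r// ge_min lexx.
pose K1 := Num.max K 1.
have K10 : 0 < K1 by rewrite lt_max ltr01 orbT.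
have [n hn] : exists n : nat, ln K1 <= b / 2 * n%:R.
  have l0 : 0 <= ln K1 by rewrite ln_ge0// le_max lexx orbT.
  exists (Num.bound (ln K1 / (b / 2))).
  rewrite mulrC -ler_pdivrMr ?divr_gt0//; apply: ltW; apply: archi_boundP.
  by rewrite divr_ge0// divr_ge0// ltW.
have [gam [gam0 hgam]] := small n.
exists (Num.min gam (b / 2)); split; first by rewrite lt_min gam0 divr_gt0.
move=> N x N1 hx1 hx2.
have mono u : Num.min gam (b / 2) <= u -> expR (- u * N%:R) <= expR (- Num.min gam (b / 2) * N%:R).
  by move=> hu; rewrite ler_expR !mulNr lerN2 ler_wpM2r.
have [Nn|nN] := leqP N n.
  apply: le_trans hx2 _; apply: le_trans (hgam N _) _; first by rewrite N1.
  by apply: mono; rewrite ge_min lexx.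
apply: le_trans hx1 _; apply: le_trans (mono (b / 2) _); last by rewrite ge_min lexx orbT.
apply: (@le_trans _ _ (K1 * expR (- (b * N%:R)))).
  by rewrite ler_wpM2r ?expR_ge0// le_max lexx.
rewrite -[K1]lnK ?posrE// -expRD ler_expR.
have : b / 2 * n%:R <= b / 2 * N%:R.
  by rewrite ler_wpM2l ?divr_ge0 ?(ltW b0)// ler_nat ltnW.
by lra.
Qed.

Theorem theorem1p1 (R : realType) (D : nat) (hD : (1 <= D)%N) (v : torus R D)
    (hirr : totally_irrational v) (hdio : diophantine v) :
  exists kappa1 : R, (kappa0 R D < kappa1%:E)%E /\
    forall kappa : R, kappa1 <= kappa ->
    exists gammam gammap : R, [/\ 0 < gammam, gammam <= gammap &
      forall P : probability (torus R D * R)%type R,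
        physical_measure v kappa P ->
        forall N : nat, (1 <= N)%N ->
          ((expR (- gammap * N%:R))%:E <= prob_expanding v kappa P N)%E /\
          (prob_expanding v kappa P N <= (expR (- gammam * N%:R))%:E)%E].
Proof.
have [c [d [c0 d1 hg]]] := g_diophantine hD hdio.
have [C C0 hC] : exists2 C : R, 0 <= C &
    forall n, \sum_(1 <= j < n.+1) - ln (g (v *+ j)) <= C * n%:R.
  apply: (@sum_ln_diophantine R (fun n => g (v *+ n)) c d c0 d1) => //.
    by rewrite mulr0n g0.
  exact: g_mulrn_sub.
have k0ge0 : (0 <= kappa0 R D)%E by exact: expeR_ge0.
have k0fin : kappa0 R D \is a fin_num by rewrite ge0_fin_numE// kappa0_lty.
exists (Num.max (expR (ln_threshold C)) (fine (kappa0 R D) + 1)); split.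
  by rewrite -[ltLHS]fineK// lte_fin lt_max ltrDl ltr01 orbT.
move=> kappa; rewrite ge_max => /andP[hk _].
have kappa_gt0 : 0 < kappa by apply: lt_le_trans hk; exact: expR_gt0.
have D0 : 0 < 5 * D%:R :> R by rewrite mulr_gt0// ltr0n.
have rate0 : 0 < decay_rate d / 2.
  by rewrite divr_gt0// mulr_gt0 ?decay_gt0// invr_gt0 (lt_trans ltr01 d1).
pose q N : R := 2^-1 * ((kappa ^- N) ^+ 2 / (5 * D%:R)) ^+ D.
have q0 N : (1 <= N)%N -> 0 < q N.
  by move=> _; rewrite mulr_gt0// exprn_gt0// divr_gt0// exprn_gt0// invr_gt0 exprn_gt0.
have [gam [gam0 hgam]] := exp_decay_of_eventual
  (upper_const c d kappa * (1 + 2 / decay_rate d)) rate0 q0.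
pose esc := escape_rate c d kappa.
(* The ball bound is a [D]-th power of a squared radius, hence [2 D] times the escape rate; its
   constant factor moves into the exponent because [N >= 1]. *)
pose gp : R := 2 * D%:R * esc + `|ln (2 * (5 * D%:R) ^+ D)|.
exists gam, (Num.max gam gp); split=> //; first by rewrite le_max lexx.
move=> P hP N N1.
have pe_fin : prob_expanding v kappa P N \is a fin_num.
  by apply: fin_num_measure; exact: measurable_expanding.
split.
  apply: le_trans (prob_expanding_ge hD hirr c0 d1 C0 hg hC hk hP N1); rewrite lee_fin.
  apply: (@le_trans _ _ (expR (- gp * N%:R))).
    by rewrite ler_expR !mulNr lerN2 ler_wpM2r// le_max lexx orbT.
  have X0 : 0 < 2 * (5 * D%:R) ^+ D :> R by rewrite mulr_gt0// exprn_gt0.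
  have -> : 2^-1 * (expR (- (escape_rate c d kappa * N%:R)) ^+ 2 / (5 * D%:R)) ^+ D =
      expR (- (2 * D%:R * esc * N%:R) - ln (2 * (5 * D%:R) ^+ D)).
    rewrite expRB lnK ?posrE// expr_div_n invfM mulrCA; congr (_ * _).
    rewrite -exprM -expRM_natl; congr expR.
    by rewrite natrM /esc; ring.
  rewrite ler_expR /gp.
  have : ln (2 * (5 * D%:R) ^+ D) <= `|ln (2 * (5 * D%:R) ^+ D)| * N%:R :> R.
    by apply: le_trans (ler_norm _) _; rewrite ler_peMr// ler1n.
  by lra.
rewrite -(fineK pe_fin) lee_fin; apply: hgam => //; rewrite -lee_fin fineK//.
  exact: (prob_expanding_decay hD c0 d1 C0 hg hC hk hP N1).
exact: (prob_expanding_lt1 hD hirr C0 hk hP N1).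
Qed.
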